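(* Let $k,\ell\in\mathbb N$ with $\ell\le k-1$, let $F$ be an $m$-vertex $k$-graph, and let $D,q,t\in\mathbb N$ and $\gamma,c>0$. Then there exist $\beta_0,\mu_0>0$ such that for all $0<\beta\le\beta_0$ and $0<\mu\le\mu_0$ there is $n_0$ such that the following holds. Let $H$ be a $k$-graph on $n\ge n_0$ vertices with $m\mid n$, and suppose that (i) $\delta_\ell(H)\ge(\delta(F,\ell,D)+\gamma)\binom{n-\ell}{k-\ell}$; (ii) $\mathcal P=\{V_1,\dots,V_d\}$ is an $(F,\beta,t,c)$-good partition of $V(H)$; (iii) $|Q(\mathcal P,L^{\mu}_{\mathcal P,F}(H))|\le q$. Then $H$ contains a perfect $F$-packing if and only if $(\mathcal P,L^{\mu}_{\mathcal P,F}(H))$ is $q$-soluble.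
   Context: A $k$-graph $H$ has edge set $E(H)\subseteq\binom{V(H)}{k}$; $\delta_\ell(H)$ is the minimum over $\ell$-sets $S$ of the number of edges containing $S$. An $F$-packing is a collection of vertex-disjoint copies of $F$ in $H$, perfect if it covers $V(H)$. $\delta(F,\ell,D)$ is the infimum of all $\delta$ such that for every $\varepsilon>0$ there is $n_1$ so that every $k$-graph on $n\ge n_1$ vertices with $\delta_\ell\ge(\delta+\varepsilon)\binom{n-\ell}{k-\ell}$ has an $F$-packing covering all but at most $D$ vertices. For a partition $\mathcal P=\{V_1,\dots,V_d\}$ of $V(H)$ (with a fixed ordering) and $S\subseteq V(H)$, the index vector $\mathbf i_{\mathcal P}(S)\in\mathbb Z^d$ has $i$th coordinate $|S\cap V_i|$. $I^\mu_{\mathcal P,F}(H)$ is the set of $\mathbf i\in\mathbb Z^d$ such that $H$ contains at least $\mu n^m$ copies of $F$ whose vertex set has index vector $\mathbf i$, and $L^\mu_{\mathcal P,F}(H)$ is the lattice in $\mathbb Z^d$ generated by $I^\mu_{\mathcal P,F}(H)$. $L^d_{\max}:=\{\mathbf v\in\mathbb Z^d: m \text{ divides } \sum_i v_i\}$ and the coset group is $Q(\mathcal P,L):=L^d_{\max}/L$. An $F$-packing $M$ in $H$ (possibly empty) of size at most $q$ is a $q$-solution for $(\mathcal P,L^\mu_{\mathcal P,F}(H))$ if $\mathbf i_{\mathcal P}(V(H)\setminus V(M))\in L^\mu_{\mathcal P,F}(H)$; the pair is $q$-soluble if a $q$-solution exists. Two vertices $u,v$ are $(F,\beta,i)$-reachable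 in $H$ if there are at least $\beta n^{im-1}$ sets $S\subseteq V(H)$ of size $im-1$ such that both $H[S\cup\{u\}]$ and $H[S\cup\{v\}]$ have perfect $F$-packings; $U\subseteq V(H)$ is $(F,\beta,i)$-closed if every two vertices of $U$ are $(F,\beta,i)$-reachable in $H$. A partition $\{V_1,\dots,V_d\}$ of $V(H)$ is $(F,\beta,t,c)$-good if each $V_i$ is $(F,\beta,t)$-closed in $H$ and $|V_i|\ge cn$ for all $i$. *)

(* Defs.v *)
From HB Require Import structures.
From mathcomp Require Import all_boot all_order all_algebra.
From mathcomp Require Import boolp classical_sets cardinality reals.

Set Implicit Arguments.
Unset Strict Implicit.
Unset Printing Implicit Defensive.

Import Order.TTheory GRing.Theory Num.Theory.
Local Open Scope set_scope.
Local Open Scope ring_scope.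

Record kgraph (k : nat) (V : finType) := KGraph {
  edges : {set {set V}};
  edges_uniform : edges \subset [set e : {set V} | #|e| == k]%SET }.

Section Hypergraphs.
Variable k : nat.

Definition degree (V : finType) (H : kgraph k V) (S : {set V}) : nat :=
  #|[set e in edges H | S \subset e]%SET|.

(* Every degree is at most the number of edges, so the initial value of the
   minimum only matters when #|V| < l; for l < k both it and the result are
   then 0. *)
Definition min_degree (l : nat) (V : finType) (H : kgraph k V) : nat :=
  \big[minn/#|edges H|]_(S : {set V} | #|S| == l) degree H S.

Lemma induced_uniform (V : finType) (H : kgraph k V) (W : {set V}) :
  [set e : {set {x : V | x \in W}} | val @: e \in edges H]%SET
    \subset [set e : {set {x : V | x \in W}} | #|e| == k]%SET.
Proof.
apply/fintype.subsetP => e; rewrite !inE => He.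
have /fintype.subsetP/(_ _ He) := edges_uniform H.
by rewrite inE card_imset //; exact: val_inj.
Qed.

Definition induced (V : finType) (H : kgraph k V) (W : {set V}) :
    kgraph k {x : V | x \in W} :=
  KGraph (induced_uniform H W).

(* A subgraph is a pair (vertex set, edge set): copies of F are unlabelled and
   need not be induced. *)
Definition subgraph (V : finType) : finType := ({set V} * {set {set V}})%type.

Definition copies (U : finType) (F : kgraph k U) (V : finType)
    (H : kgraph k V) : {set subgraph V} :=
  [set C : subgraph V | (C.2 \subset edges H) &&
    [exists f : {ffun U -> V},
      [&& injectiveb f, C.1 == f @: [set: U]%SET
        & C.2 == [set f @: (e : {set U}) | e in edges F]%SET]]]%SET.

Definition packing (U : finType) (F : kgraph k U) (V : finType)
    (H : kgraph k V) (M : {set subgraph V}) : Prop :=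
  M \subset copies F H /\
  {in M &, forall C C' : subgraph V, C != C' -> [disjoint C.1 & C'.1]}.

Definition covered (V : finType) (M : {set subgraph V}) : {set V} :=
  (\bigcup_(C in M) C.1)%SET.

Definition has_perfect_packing (U : finType) (F : kgraph k U) (V : finType)
    (H : kgraph k V) : Prop :=
  exists M : {set subgraph V}, packing F H M /\ covered M = [set: V]%SET.

(* The constraint 0 <= delta excludes nothing when F has an edge (for a
   negative delta, large edgeless graphs H are counterexamples); it only
   prevents the infimum from being -oo for some edgeless F. The set contains 1
   when l < k, since the degree condition then fails for large n. *)
Definition packing_threshold (R : realType) (U : finType) (F : kgraph k U)
    (l D : nat) : R :=
  inf [set delta : R | 0 <= delta /\
    forall eps : R, 0 < eps -> exists n1 : nat,
      forall (V : finType) (H : kgraph k V), (n1 <= #|V|)%N ->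
        (delta + eps) * 'C(#|V| - l, k - l)%:R <= (min_degree l H)%:R ->
        exists M : {set subgraph V},
          packing F H M /\ (#|~: covered M| <= D)%N]%classic.

Definition ordered_partition (V : finType) (d : nat) (P : 'I_d -> {set V}) :
    Prop :=
  injective P /\
  finset.partition [set P i | i : 'I_d]%SET [set: V]%SET.

Definition index_vector (V : finType) (d : nat) (P : 'I_d -> {set V})
    (S : {set V}) : 'rV[int]_d :=
  \row_i (#|S :&: P i|%:Z).

Definition lattice_generated (d : nat) (I : set 'rV[int]_d) : set 'rV[int]_d :=
  smallest
    [set A : set 'rV[int]_d |
      A 0 /\ forall u v, A u -> A v -> A (u - v)]%classic I.

Definition robust_index_vectors (R : realType) (mu : R) (V : finType) (d : nat)
    (P : 'I_d -> {set V}) (U : finType) (F : kgraph k U) (H : kgraph k V) :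
    set 'rV[int]_d :=
  [set i : 'rV[int]_d | mu * #|V|%:R ^+ #|U| <=
    #|[set C in copies F H | index_vector P C.1 == i]%SET|%:R]%classic.

Definition robust_lattice (R : realType) (mu : R) (V : finType) (d : nat)
    (P : 'I_d -> {set V}) (U : finType) (F : kgraph k U) (H : kgraph k V) :
    set 'rV[int]_d :=
  lattice_generated (robust_index_vectors mu P F H).

Definition max_lattice (m d : nat) : set 'rV[int]_d :=
  [set v : 'rV[int]_d | (m%:Z %| \sum_i v 0 i)%Z]%classic.

Definition lattice_coset (d : nat) (L : set 'rV[int]_d) (v : 'rV[int]_d) :
    set 'rV[int]_d :=
  [set w : 'rV[int]_d | L (w - v)]%classic.

(* The underlying set of the quotient group L_max / L. *)
Definition coset_group (m d : nat) (L : set 'rV[int]_d) :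
    set (set 'rV[int]_d) :=
  [set lattice_coset L v | v in @max_lattice m d]%classic.

Definition soluble (q : nat) (V : finType) (d : nat) (P : 'I_d -> {set V})
    (L : set 'rV[int]_d) (U : finType) (F : kgraph k U) (H : kgraph k V) :
    Prop :=
  exists M : {set subgraph V},
    [/\ packing F H M, (#|M| <= q)%N & L (index_vector P (~: covered M))].

Definition reachable (R : realType) (U : finType) (F : kgraph k U) (beta : R)
    (i : nat) (V : finType) (H : kgraph k V) (u v : V) : Prop :=
  beta * #|V|%:R ^+ (i * #|U| - 1) <=
    #|[set S : {set V} | (#|S| == (i * #|U| - 1)%N) &&
        `[< has_perfect_packing F (induced H (u |: S)) /\
            has_perfect_packing F (induced H (v |: S)) >]]%SET|%:R.

Definition closed_in (R : realType) (U : finType) (F : kgraph k U) (beta : R)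
    (i : nat) (V : finType) (H : kgraph k V) (A : {set V}) : Prop :=
  {in A &, forall u v, u != v -> reachable F beta i H u v}.

Definition good_partition (R : realType) (U : finType) (F : kgraph k U)
    (beta : R) (t : nat) (c : R) (V : finType) (H : kgraph k V) (d : nat)
    (P : 'I_d -> {set V}) : Prop :=
  ordered_partition P /\
  forall i : 'I_d, closed_in F beta t H (P i) /\ c * #|V|%:R <= #|P i|%:R.

End Hypergraphs.

(* Main.v *)
(* Necessity: among the subpackings N of a perfect packing whose complement has
   index vector in L, a smallest one has at most q members, because two of q + 1
   nested partial sums would lie in the same coset of L.

   Sufficiency: after the q-solution M0 is removed, one sets aside a small
   packing M such that every set Z with at most D + q m vertices and with index
   vector in L satisfies: some subpacking of M, disjoint from Z, has a vertex set
   whose union with Z is again perfectly packable. The degree condition covers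
   all other vertices except for a set W of at most D vertices by a packing N.
   The coset argument, applied to M and N together, gives at most q copies whose
   union Z with W has index vector in L, and M absorbs this Z. It does not matter
   that some of these copies may come from M, since the absorber is required to
   be disjoint from Z; hence beta and mu need not be compared.

   An absorber of Z comes from writing i(Z) as a difference of sums of robust
   index vectors and joining the vertices by closedness. Each Z thus has absorbers
   of positive density, so by averaging some vertex set absorbs a fixed proportion
   of the sets Z not yet absorbed. Choosing such sets greedily reduces the number
   of unabsorbed Z, initially polynomial in n, geometrically, and all are absorbed
   within a number of steps that is an arbitrarily small fraction of n. *)

Require Import Defs.
From HB Require Import structures.
From mathcomp Require Import all_boot all_order all_algebra.
From mathcomp Require Import boolp classical_sets functions cardinality reals.
From mathcomp Require Import ssrnat fintype finset zify ring lra.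

Set Implicit Arguments.
Unset Strict Implicit.
Unset Printing Implicit Defensive.

Import Order.TTheory GRing.Theory Num.Theory.
Local Open Scope ring_scope.

(** * Averages over random vertices *)

Lemma disjoint_set0 (W : finType) (A : {set W}) : [disjoint @finset.set0 W & A].
Proof. by rewrite -setI_eq0 set0I. Qed.

Lemma leq_card_bigcup (I W : finType) (P : pred I) (F : I -> {set W}) :
  (#|\bigcup_(i | P i) F i| <= \sum_(i | P i) #|F i|)%N.
Proof.
elim/big_rec2: _ => [|i n A _ IH]; first by rewrite cards0.
by apply: leq_trans (leq_card_setU _ _) _; rewrite leq_add2l.
Qed.

Section RandomVertices.
Variables (R : realType) (V : finType).
Implicit Types (f g : {set V} -> R) (A E X : {set V}) (T s : nat).

(* The expectation of f at the set of T independent uniform vertices. *)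
Fixpoint avg T f : R :=
  if T is T'.+1 then #|V|%:R^-1 * \sum_(v : V) avg T' (fun A => f (v |: A)%SET)
  else f (finset.set0).

Lemma eq_avg T f g : f =1 g -> avg T f = avg T g.
Proof.
elim: T f g => [|T IH] f g fg /=; first exact: fg.
by congr (_ * _); apply: eq_bigr => v _; apply: IH => A; exact: fg.
Qed.

Lemma le_avg T f g :
  (forall A, (#|A| <= T)%N -> f A <= g A) -> avg T f <= avg T g.
Proof.
elim: T f g => [|T IH] f g fg /=; first by apply: fg; rewrite cards0.
rewrite ler_wpM2l ?invr_ge0 ?ler0n // ler_sum // => v _; apply: IH => A AT.
by apply: fg; rewrite cardsU1 -add1n leq_add // leq_b1.
Qed.

Lemma avg_ge0 T f : (forall A, 0 <= f A) -> 0 <= avg T f.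
Proof.
elim: T f => [|T IH] f f0 /=; first exact: f0.
by rewrite mulr_ge0 ?invr_ge0 ?ler0n ?sumr_ge0 // => v _; apply: IH => A.
Qed.

Lemma avg_sum (I : finType) (P : pred I) (F : I -> {set V} -> R) T :
  avg T (fun A => \sum_(i | P i) F i A) = \sum_(i | P i) avg T (F i).
Proof.
elim: T F => [|T IH] F //=.
rewrite -mulr_sumr exchange_big /=; congr (_ * _).
by apply: eq_bigr => v _; rewrite (IH (fun i A => F i (v |: A)%SET)).
Qed.

Lemma avgMr T f (a : R) : avg T (fun A => f A * a) = avg T f * a.
Proof.
elim: T f => [|T IH] f //=.
by rewrite -mulrA mulr_suml; congr (_ * _); apply: eq_bigr => v _; rewrite IH.
Qed.

Lemma avg_le_bound T f (a : R) :
  0 <= a -> (forall A, f A <= a) -> avg T f <= a.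
Proof.
move=> a0; elim: T f => [|T IH] f fa /=; first exact: fa.
(* For empty [V] the average is 0, since the inverse of 0 is 0; this is where [0 <= a] enters. *)
have [V0|V0] := posnP #|V|; first by rewrite V0 invr0 mul0r.
rewrite ler_pdivrMl ?ltr0n //.
apply: (@le_trans _ _ (\sum_(v : V) a)); first by apply: ler_sum => v _; exact: IH.
by rewrite sumr_const mulr_natl.
Qed.

Lemma avg_add s T f :
  avg (s + T) f = avg s (fun E => avg T (fun A => f (E :|: A)%SET)).
Proof.
elim: s f => [|s IH] f /=; first by apply: eq_avg => A; rewrite set0U.
congr (_ * _); apply: eq_bigr => v _; rewrite IH.
by apply: eq_avg => E; apply: eq_avg => A; rewrite setUA.
Qed.

Lemma card_uniform_sets_succ s (Q : pred {set V}) :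
  (#|[set E : {set V} | (#|E| == s.+1) && Q E]%SET| <=
    \sum_(v : V) #|[set E : {set V} | (#|E| == s) && Q (v |: E)]%SET|)%N.
Proof.
apply: (@leq_trans #|\bigcup_(v : V)
   [set (v |: E)%SET | E in [set E : {set V} | (#|E| == s) && Q (v |: E)]]%SET|%SET).
  apply/subset_leq_card/fintype.subsetP => E; rewrite inE => /andP[/eqP Es QE].
  have [v vE] : exists v, v \in E by apply/set0Pn; rewrite -card_gt0 Es.
  apply/bigcupP; exists v => //; apply/imsetP; exists (E :\ v)%SET.
    by rewrite inE setD1K // QE andbT; move: Es; rewrite (cardsD1 v) vE add1n => -[->].
  by rewrite setD1K.
apply: (leq_trans (leq_card_bigcup _ _)).
by apply: leq_sum => v _; exact: leq_imset_card.
Qed.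

(** Every [s]-set is the set of entries of at least one of the n^s sequences of [s] vertices; the
    factor s! is given away. *)
Lemma avg_ge_card s (Q : pred {set V}) :
  #|[set E : {set V} | (#|E| == s) && Q E]%SET|%:R / #|V|%:R ^+ s
    <= avg s (fun E => (Q E)%:R).
Proof.
elim: s Q => [|s IH] Q /=.
  rewrite expr0 divr1 ler_nat; case: (boolP (Q _)) => QE /=.
    rewrite -(cards1 (@finset.set0 V)); apply/subset_leq_card/fintype.subsetP => E.
    by rewrite !inE cards_eq0 => /andP[].
  rewrite leqn0 cards_eq0; apply/eqP/setP => E; rewrite !inE cards_eq0.
  by apply/negP => /andP[/eqP ->]; exact/negP.
(* For empty [V] both sides are 0, again by the convention for the inverse of 0. *)
have [V0|V0] := posnP #|V|; first by rewrite V0 expr0n invr0 mulr0 mul0r.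
rewrite exprS invfM mulrCA ler_pM2l ?invr_gt0 ?ltr0n //.
apply: (le_trans _ (ler_sum _ (fun v _ => IH (fun E => Q (v |: E)%SET)))).
rewrite -mulr_suml ler_pM2r ?invr_gt0 ?exprn_gt0 ?ltr0n //.
by rewrite -natr_sum ler_nat card_uniform_sets_succ.
Qed.

(** The first [s] random vertices form an [s]-set satisfying [Q] with probability at least [a], and
    given such a set the other [T] contribute at least [b]. Absorbers are assembled piece by piece
    in this way. *)
Lemma avg_extend s T f (Q : pred {set V}) (a b : R) :
  (forall A, 0 <= f A) -> 0 <= b ->
  a * #|V|%:R ^+ s <= #|[set E : {set V} | (#|E| == s) && Q E]%SET|%:R ->
  (0 < #|V|)%N ->
  (forall E, #|E| = s -> Q E -> b <= avg T (fun A => f (E :|: A)%SET)) ->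
  a * b <= avg (s + T) f.
Proof.
move=> f0 b0 Qa V0 Qb; rewrite avg_add.
pose Qs (E : {set V}) := (#|E| == s) && Q E.
apply: (@le_trans _ _ (avg s (fun E => (Qs E)%:R * b))).
  rewrite avgMr; apply: ler_wpM2r => //; apply: le_trans (avg_ge_card _ _).
  rewrite ler_pdivlMr ?exprn_gt0 ?ltr0n // (le_trans Qa) // ler_nat.
  by apply/subset_leq_card/fintype.subsetP => E; rewrite !inE /Qs => /andP[-> ->].
apply: le_avg => E _; case QE : (Qs E); last by rewrite mul0r avg_ge0.
by rewrite mul1r; case/andP: QE => /eqP Es QE; exact: Qb.
Qed.

(** A set that meets [X] is a vertex of [X] together with s - 1 further vertices, so there are at
    most |X| n^(s-1) of them. *)
Lemma card_uniform_meeting s X :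
  (#|V| * #|[set E : {set V} | (#|E| == s) && ~~ [disjoint E & X]]%SET|
    <= #|X| * #|V| ^ s)%N.
Proof.
case: s => [|s].
  rewrite (_ : [set _ | _]%SET = finset.set0) ?cards0 ?muln0 //.
  apply/setP => E; rewrite !inE cards_eq0; apply/negP => /andP[/eqP ->].
  by rewrite -setI_eq0 set0I eqxx.
rewrite expnS mulnCA leq_mul2l; apply/orP; right.
apply: (@leq_trans (\sum_(x in X) #|[set E : {set V} | #|E| == s]%SET|)).
  apply: (@leq_trans #|\bigcup_(x in X)
     [set (x |: E)%SET | E in [set E : {set V} | (#|E| == s)]]%SET|%SET).
    apply/subset_leq_card/fintype.subsetP => E; rewrite inE => /andP[/eqP Es].
    rewrite -setI_eq0 => /set0Pn[v]; rewrite inE => /andP[vE vX].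
    apply/bigcupP; exists v => //; apply/imsetP; exists (E :\ v)%SET.
      by rewrite inE; move: Es; rewrite (cardsD1 v) vE add1n => -[->].
    by rewrite setD1K.
  apply: (leq_trans (leq_card_bigcup _ _)).
  by apply: leq_sum => v _; exact: leq_imset_card.
rewrite sum_nat_const leq_mul2l; apply/orP; right.
rewrite card_draws.
elim: s (#|V|) => [|s IH] n; first by rewrite bin0 expn0.
rewrite expnS -(leq_pmul2l (ltn0Sn s)) mul_bin_left.
apply: (@leq_trans (n * n ^ s)); last by rewrite leq_pmull.
by rewrite leq_mul // leq_subr.
Qed.

(** At most a n^s of the [s]-sets meet [X], so half of the assumed density survives. *)
Lemma card_uniform_avoiding s X (Q : pred {set V}) (a : R) :
  a *+ 2 * #|V|%:R ^+ s <= #|[set E : {set V} | (#|E| == s) && Q E]%SET|%:R ->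
  (0 < #|V|)%N -> #|X|%:R <= a * #|V|%:R ->
  a * #|V|%:R ^+ s <=
    #|[set E : {set V} | (#|E| == s) && (Q E && [disjoint E & X])]%SET|%:R.
Proof.
move=> Qa V0 Xa.
set m := #|[set E : {set V} | (#|E| == s) && ~~ [disjoint E & X]]%SET|.
have ma : m%:R <= a * #|V|%:R ^+ s :> R.
  have := card_uniform_meeting s X; rewrite -/m -(ler_nat R) !natrM natrX => mX.
  rewrite -(@ler_pM2l _ #|V|%:R) ?ltr0n //; apply: (le_trans mX).
  by rewrite mulrA [_ * a]mulrC ler_pM2r // exprn_gt0 ?ltr0n.
rewrite -(lerD2r m%:R); apply: le_trans (_ : _ <= a *+ 2 * #|V|%:R ^+ s) _.
  by rewrite mulrnAl mulr2n lerD2l.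
apply: (le_trans Qa); rewrite -natrD ler_nat.
apply: leq_trans (leq_card_setU _ _); apply/subset_leq_card/fintype.subsetP => E.
by rewrite !inE => /andP[-> ->] /=; case: [disjoint E & X].
Qed.
End RandomVertices.

(** * Packings and index vectors *)

Section Packings.
Variables (k : nat) (U : finType) (F : kgraph k U) (V : finType) (H : kgraph k V).
Implicit Types (M N : {set subgraph V}) (A E X Y : {set V}) (C : subgraph V).

(** Packings are taken in [H] itself rather than in an induced hypergraph, so that all vertex sets
    live on one type and can be united freely. *)
Definition packable X : Prop := exists M, packing F H M /\ covered M = X.

Lemma card_copy C : C \in copies F H -> #|C.1| = #|U|.
Proof.
rewrite inE => /andP[_ /existsP[f /and3P[/injectiveP finj /eqP -> _]]].
by rewrite card_imset // cardsT.
Qed.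

Lemma sub_packing M N : N \subset M -> packing F H M -> packing F H N.
Proof.
move=> NM [Mc Md]; split; first exact: fintype.subset_trans NM Mc.
by move=> C C' CN C'N; apply: Md; apply: (fintype.subsetP NM).
Qed.

Lemma coveredU M N : covered (M :|: N) = (covered M :|: covered N)%SET.
Proof. exact: bigcup_setU. Qed.

Lemma sub_covered M N : N \subset M -> covered N \subset covered M.
Proof.
move=> NM; apply/bigcupsP => C CN; apply: (finset.bigcup_sup C) => //.
exact: (fintype.subsetP NM).
Qed.

Lemma packingU M N : packing F H M -> packing F H N ->
  [disjoint covered M & covered N] -> packing F H (M :|: N)%SET.
Proof.
move=> [Mc Md] [Nc Nd] MN; split; first by rewrite finset.subUset Mc.
have dis C C' : C \in M -> C' \in N -> [disjoint C.1 & C'.1].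
  move=> CM C'N; apply: disjointWl (disjointWr _ MN).
    exact: (finset.bigcup_sup C).
  exact: (finset.bigcup_sup C').
move=> C C'; rewrite !inE => /orP[CM|CN] /orP[C'M|C'N] CC'.
- exact: Md.
- exact: dis.
- by rewrite disjoint_sym; exact: dis.
- exact: Nd.
Qed.

Lemma packing0 : packing F H finset.set0.
Proof. by split => [|C C']; rewrite ?finset.sub0set // inE. Qed.

Lemma covered0 : covered (@finset.set0 (subgraph V)) = finset.set0.
Proof. exact: big_set0. Qed.

Lemma packable0 : packable finset.set0.
Proof. by exists finset.set0; split; [exact: packing0 | exact: covered0]. Qed.

Lemma packable_copy C : C \in copies F H -> packable C.1.
Proof.
move=> CH; exists [set C]%SET; split; last exact: big_set1.
split; first by rewrite finset.sub1set.
by move=> C1 C2; rewrite !inE => /eqP -> /eqP ->; rewrite eqxx.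
Qed.

Lemma packableU X Y :
  packable X -> packable Y -> [disjoint X & Y] -> packable (X :|: Y)%SET.
Proof.
move=> [M [pM <-]] [N [pN <-]] XY; exists (M :|: N)%SET.
by split; [exact: packingU | exact: coveredU].
Qed.

Lemma leq_card_covered M :
  M \subset copies F H -> (#|covered M| <= #|M| * #|U|)%N.
Proof.
move=> MH; apply: (leq_trans (leq_card_bigcup _ _)).
rewrite (eq_bigr (fun=> #|U|)) ?sum_nat_const // => C CM.
exact/card_copy/(fintype.subsetP MH).
Qed.

Lemma disjoint_covered M N N' : packing F H M -> N \subset M -> N' \subset M ->
  [disjoint N & N'] -> [disjoint covered N & covered N'].
Proof.
move=> [_ Md] NM N'M NN'; rewrite -setI_eq0; apply/set0Pn => -[v].
rewrite inE => /andP[/bigcupP[C CN vC] /bigcupP[C' CN' vC']].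
have CC' : C != C'.
  by apply/eqP => E; move: NN'; rewrite -setI_eq0 => /set0Pn[];
     exists C; rewrite inE CN E.
have := Md _ _ (fintype.subsetP NM _ CN) (fintype.subsetP N'M _ CN') CC'.
by rewrite -setI_eq0 => /set0Pn[]; exists v; rewrite inE vC.
Qed.

Lemma packing_of_induced (W : {set V}) (M : {set subgraph {x : V | x \in W}}) :
  packing F (induced H W) M ->
  exists N, packing F H N /\ covered N = (val @: covered M)%SET.
Proof.
move=> [Mc Md].
pose up (C : subgraph {x : V | x \in W}) : subgraph V :=
  ((val @: C.1)%SET, [set (val @: (e : {set {x : V | x \in W}}))%SET | e in C.2]%SET).
exists (up @: M)%SET; split; last first.
  rewrite /covered; apply/setP => v; apply/bigcupP/imsetP.
    move=> [_ /imsetP[C CM ->]] /imsetP[x xC ->]; exists x => //.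
    by apply/bigcupP; exists C.
  move=> [x /bigcupP[C CM xC] ->]; exists (up C); first exact: imset_f.
  exact: imset_f.
split.
  apply/fintype.subsetP => _ /imsetP[C CM ->].
  have := fintype.subsetP Mc _ CM; rewrite !inE => /andP[CE].
  move=> /existsP[f /and3P[/injectiveP finj /eqP C1 /eqP C2]].
  apply/andP; split.
    apply/fintype.subsetP => _ /imsetP[e eC ->].
    by have := fintype.subsetP CE _ eC; rewrite inE.
  apply/existsP; exists [ffun x => val (f x)]; apply/and3P; split.
  - by apply/injectiveP => x y; rewrite !ffunE => /val_inj/finj.
  - rewrite /up /= C1 -imset_comp; apply/eqP/eq_imset => x.
    by rewrite /= ffunE.
  - rewrite /up /= C2 -imset_comp; apply/eqP/eq_imset => e.
    by rewrite /= -imset_comp; apply: eq_imset => x; rewrite /= ffunE.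
move=> _ _ /imsetP[C CM ->] /imsetP[C' C'M ->] CC'.
have {}CC' : C != C' by apply: contraNneq CC' => ->.
have := Md _ _ CM C'M CC'; rewrite -!setI_eq0 /up /= -imsetI.
  by move=> /eqP ->; rewrite imset0.
by move=> x y _ _; exact: val_inj.
Qed.

Lemma packable_of_induced (W : {set V}) :
  has_perfect_packing F (induced H W) -> packable W.
Proof.
move=> [M [pM cM]]; have [N [pN cN]] := packing_of_induced pM.
exists N; split=> //; rewrite cN cM; apply/setP => v; apply/imsetP/idP.
  by move=> [x _ ->]; exact: valP.
by move=> vW; exists (Sub v vW).
Qed.

(* Copies are counted with their edge sets, so a vertex set may be the vertex
   set of several copies. *)
Lemma card_copies_le (Q : pred {set V}) :
  (#|[set C in copies F H | Q C.1]%SET| <= #|[set E : {set V} |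
     (#|E| == #|U|) && (Q E && [exists C in copies F H, C.1 == E])]%SET|
   * #|U| ^ #|U|)%N.
Proof.
set G := [set E : {set V} | _ & _]%SET.
apply: (@leq_trans #|\bigcup_(E in G) [set C in copies F H | C.1 == E]%SET|%SET).
  apply/subset_leq_card/fintype.subsetP => C; rewrite inE => /andP[CH QC].
  apply/bigcupP; exists C.1; last by rewrite inE CH eqxx.
  rewrite inE card_copy // eqxx QC; apply/existsP; exists C.
  by rewrite CH eqxx.
apply: (leq_trans (leq_card_bigcup _ _)).
rewrite -sum_nat_const; apply: leq_sum => E; rewrite inE => /andP[/eqP Em _].
(* A copy with vertex set [E] is the image of a map from [U] into [E], and there are m^m such
   maps. *)
pose cp (f : {ffun U -> V}) : subgraph V :=
  ((f @: [set: U])%SET, [set (f @: (e : {set U}))%SET | e in edges F]%SET).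
apply: (@leq_trans #|[set cp f | f in ffun_on (mem E)]%SET|).
  apply/subset_leq_card/fintype.subsetP => -[C1 C2].
  rewrite !inE /= => /andP[/andP[_ /existsP[f /and3P[_ /eqP C1f /eqP C2f]]] /eqP C1E].
  apply/imsetP; exists f; last by rewrite /cp -C1f -C2f.
  by apply/ffun_onP => x; rewrite -C1E C1f imset_f.
by apply: (leq_trans (leq_imset_card _ _)); rewrite card_ffun_on Em.
Qed.
End Packings.

Section IndexVectors.
Variables (V : finType) (d : nat) (P : 'I_d -> {set V}).
Implicit Types (A B S : {set V}).

Lemma index_vectorU A B : [disjoint A & B] ->
  index_vector P (A :|: B)%SET = index_vector P A + index_vector P B.
Proof.
rewrite -setI_eq0 => /eqP AB; apply/rowP => i; rewrite !mxE setIUl cardsU.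
rewrite setIACA AB set0I cards0 subn0; exact: PoszD.
Qed.

Lemma index_vector0 : index_vector P finset.set0 = 0.
Proof. by apply/rowP => i; rewrite !mxE set0I cards0. Qed.

Lemma index_covered k (U : finType) (F : kgraph k U) (H : kgraph k V) M :
  packing F H M ->
  index_vector P (covered M) = \sum_(C in M) index_vector P C.1.
Proof.
move En : #|M| => n; elim: n M En => [|n IH] M.
  by move/eqP; rewrite cards_eq0 => /eqP -> _; rewrite covered0 big_set0 index_vector0.
move=> Mn pM; have [C CM] : exists C, C \in M by apply/set0Pn; rewrite -card_gt0 Mn.
have Dsub : (M :\ C)%SET \subset M := finset.subsetDl _ _.
rewrite -{1}(setD1K CM) coveredU index_vectorU; last first.
  apply: disjoint_covered pM _ Dsub _; first by rewrite finset.sub1set.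
  by rewrite -setI_eq0; apply/eqP/setP => x; rewrite !inE; case: eqP.
have Dn : #|(M :\ C)%SET| = n.
  by apply/eqP; rewrite -eqSS -Mn (cardsD1 C M) CM add1n.
rewrite (IH (M :\ C)%SET) //; last exact: sub_packing Dsub pM.
by rewrite [covered [set C]%SET]big_set1 [RHS](big_setD1 C).
Qed.

Hypothesis partP : ordered_partition P.

Lemma partition_index (x : V) : exists2 i, x \in P i & forall j, x \in P j -> j = i.
Proof.
case: partP => Pinj /and3P[/eqP cov triv _].
have : x \in finset.cover [set P i | i : 'I_d]%SET by rewrite cov inE.
move=> /bigcupP[_ /imsetP[i _ ->] xi]; exists i => // j xj; apply: Pinj.
apply/eqP; apply: contraLR xj => neq.
have := finset.trivIsetP triv (P j) (P i) (imset_f _ _) (imset_f _ _) neq.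
move=> /(_ isT isT); rewrite -setI_eq0 => /eqP/setP/(_ x).
by rewrite !inE xi andbT => ->.
Qed.

Lemma sum_index_vector S : \sum_i index_vector P S 0 i = #|S|%:Z.
Proof.
transitivity ((\sum_(i < d) #|S :&: P i|%SET)%N%:Z).
  by rewrite (big_morph Posz PoszD (erefl _)); apply: eq_bigr => i _; rewrite mxE.
congr Posz; rewrite -[RHS]sum1_card.
transitivity (\sum_(i < d) \sum_(x in S) (x \in P i))%N.
  apply: eq_bigr => i _; rewrite -sum1_card [RHS]big_mkcond [LHS]big_mkcond /=.
  by apply: eq_bigr => x _; rewrite inE; case: (x \in S); case: (x \in P i).
rewrite exchange_big /=; apply: eq_bigr => x _.
have [i xi xj] := partition_index x.
rewrite (bigD1 i) //= xi big1 // => j ji.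
by apply/eqP; rewrite eqb0; apply: contra ji => /xj ->.
Qed.

Lemma sum_card_parts : (\sum_(i < d) #|P i|)%N = #|V|.
Proof.
apply/eqP; rewrite -eqz_nat -[#|V|]cardsT -sum_index_vector.
rewrite (big_morph Posz PoszD (erefl _)); apply/eqP/eq_bigr => i _.
by rewrite mxE setTI.
Qed.
End IndexVectors.

(** * Lattices *)

Section Lattices.
Variable d : nat.
Implicit Types (L I : set 'rV[int]_d) (u v : 'rV[int]_d).

Definition is_lattice L : Prop := L 0 /\ forall u v, L u -> L v -> L (u - v).

Lemma lattice_generated_is_lattice I : is_lattice (lattice_generated I).
Proof.
split=> [A [[A0 _] _] //|u v Iu Iv A AI].
by case: (AI) => -[_ AB] _; apply: AB; [exact: Iu | exact: Iv].
Qed.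

(** The differences of two sums over [I] already form a lattice containing [I]. Integer coefficients
    appear as repetitions in the two lists. *)
Lemma lattice_generated_difference I v : lattice_generated I v ->
  exists xs ys : seq 'rV[int]_d,
    [/\ forall x, x \in xs -> I x, forall y, y \in ys -> I y &
        v = \sum_(x <- xs) x - \sum_(y <- ys) y].
Proof.
move=> /(_ [set w : 'rV[int]_d | exists xs ys : seq 'rV[int]_d,
  [/\ forall x, x \in xs -> I x, forall y, y \in ys -> I y &
        w = \sum_(x <- xs) x - \sum_(y <- ys) y]]%classic); apply.
split; first split.
- by exists [::], [::]; split => //; rewrite !big_nil subr0.
- move=> u w [xs [ys [xsI ysI ->]]] [xs' [ys' [xsI' ysI' ->]]].
  exists (xs ++ ys'), (ys ++ xs'); split.
  + by move=> x; rewrite mem_cat => /orP[/xsI|/ysI'].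
  + by move=> x; rewrite mem_cat => /orP[/ysI|/xsI'].
  + by rewrite !big_cat /= opprB addrACA -opprD.
- move=> w Iw; exists [:: w], [::]; split => // [x|].
    by rewrite inE => /eqP ->.
  by rewrite big_seq1 big_nil subr0.
Qed.

(* Among the cosets of q + 1 nested partial sums two agree, and their
   difference can be dropped from the sum. *)
Lemma lattice_subsum (T : finType) m q L (g : T -> 'rV[int]_d) (M : {set T}) v :
  is_lattice L -> (forall C, C \in M -> max_lattice m (g C)) ->
  (coset_group m L #<= `I_q)%card -> L (v + \sum_(C in M) g C) ->
  exists N : {set T}, [/\ N \subset M, (#|N| <= q)%N & L (v + \sum_(C in N) g C)].
Proof.
move=> [L0 LB] gM Lq; move En : #|M| => n.
elim/ltn_ind: n M En gM => n IH M En gM LM.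
have [nq|qn] := leqP n q; first by exists M; rewrite En.
pose S (j : nat) : {set T} := [set C in take j (enum M)]%SET.
have SM j : S j \subset M.
  by apply/fintype.subsetP => C; rewrite inE => /mem_take; rewrite mem_enum.
have Smax j : max_lattice m (\sum_(C in S j) g C).
  rewrite /max_lattice /= (eq_bigr (fun i => \sum_(C in S j) g C 0 i)); last first.
    by move=> i _; rewrite summxE.
  rewrite exchange_big /=; apply: rpred_sum => C CS.
  exact: gM (fintype.subsetP (SM j) _ CS).
have [f [fq finj]] : exists f : set 'rV[int]_d -> nat,
    (forall A, coset_group m L A -> (f A < q)%N) /\
    (forall A B, coset_group m L A -> coset_group m L B -> f A = f B -> A = B).
  have /pcard_leP[f] := Lq.
  exists f; split => [A AL|A B AL BL]; first exact: (@funS _ _ _ _ f).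
  by apply: (@inj _ _ _ f); exact: mem_set.
pose h (j : 'I_q.+1) := lattice_coset L (\sum_(C in S j) g C).
have hL j : coset_group m L (h j) by exists (\sum_(C in S j) g C) => //; exact: Smax.
have [a [b [ab hab]]] : exists a b : 'I_q.+1, (a < b)%N /\ h a = h b.
  have : ~ injective (fun j => Ordinal (fq _ (hL j))).
    by move/leq_card; rewrite !card_ord ltnn.
  move=> ninj; apply: contrapT => nab; apply: ninj => a b /(congr1 val) /= fab.
  have hab := finj _ _ (hL a) (hL b) fab.
  case: (ltngtP a b) => [lt|gt|/val_inj //]; exfalso; apply: nab.
    by exists a, b.
  by exists b, a.
have Lab : L (\sum_(C in S b) g C - \sum_(C in S a) g C).
  have : h b (\sum_(C in S b) g C) by rewrite /h /lattice_coset /= subrr.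
  by rewrite -hab.
have Sab : S a \subset S b.
  apply/fintype.subsetP => C; rewrite !inE -(subnKC (ltnW ab)) takeD mem_cat => ->.
  by [].
pose N := (M :\: (S b :\: S a))%SET.
(* Since q < |M|, the prefixes [S j] with j <= q have exactly j elements. The block that is dropped
   is therefore nonempty, and the induction on |M| advances. *)
have [C0 C0b] : exists C, C \in (S b :\: S a)%SET.
  apply/set0Pn; rewrite -card_gt0 cardsDS // subn_gt0.
  have cS j : (j <= q)%N -> #|S j| = j.
    move=> jq; rewrite cardsE (card_uniqP _) ?take_uniq ?enum_uniq //.
    by rewrite size_take -cardE En (leq_ltn_trans jq qn).
  by rewrite !cS // -ltnS.
have Nsum : \sum_(C in N) g C =
    \sum_(C in M) g C - (\sum_(C in S b) g C - \sum_(C in S a) g C).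
  have Sb : \sum_(C in S b) g C = \sum_(C in S a) g C + \sum_(C in (S b :\: S a)%SET) g C.
    by rewrite (big_setID (S a)) /= (setIidPr Sab).
  have SbM : (S b :\: S a)%SET \subset M.
    exact: fintype.subset_trans (finset.subsetDl _ _) (SM b).
  rewrite Sb [\sum_(C in M) g C](big_setID (S b :\: S a)%SET) /= (setIidPr SbM) -/N.
  by rewrite [X in _ - (X - _)]addrC addrK addrAC subrr add0r.
have NM : N \subset M := finset.subsetDl _ _.
have Nn : (#|N| < n)%N.
  rewrite -En; apply: proper_card; apply/properP; split => //.
  exists C0; last by rewrite !inE; move: C0b; rewrite !inE => ->.
  by apply: (fintype.subsetP (SM b)); move: C0b; rewrite inE => /andP[].
have [C CN||N' [N'N N'q LN']] := IH _ Nn N (erefl _).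
- exact: gM (fintype.subsetP NM _ CN).
- by rewrite Nsum addrA; exact: LB.
by exists N'; split => //; exact: fintype.subset_trans N'N NM.
Qed.
End Lattices.

Definition bounded_row d (B : nat) (v : 'rV[int]_d) : Prop :=
  forall i, exists2 a : nat, (a <= B)%N & v 0 i = a%:Z.

(* There are only finitely many generating sets and targets to consider. *)
Lemma lattice_generated_bound (dmax m B : nat) : exists K : nat,
  forall d (I : set 'rV[int]_d) (v : 'rV[int]_d), (d <= dmax)%N ->
  (forall u, I u -> bounded_row m u) -> bounded_row B v -> lattice_generated I v ->
  exists xs ys : seq 'rV[int]_d,
    [/\ forall x, x \in xs -> I x, forall y, y \in ys -> I y,
        v = \sum_(x <- xs) x - \sum_(y <- ys) y & (size xs + size ys <= K)%N].
Proof.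
have fixed d : exists K : nat,
  forall (I : set 'rV[int]_d) (v : 'rV[int]_d),
  (forall u, I u -> bounded_row m u) -> bounded_row B v -> lattice_generated I v ->
  exists xs ys : seq 'rV[int]_d,
    [/\ forall x, x \in xs -> I x, forall y, y \in ys -> I y,
        v = \sum_(x <- xs) x - \sum_(y <- ys) y & (size xs + size ys <= K)%N].
  pose row b (c : {ffun 'I_d -> 'I_b.+1}) : 'rV[int]_d := \row_i (c i)%:Z.
  have rowP b (v : 'rV[int]_d) : bounded_row b v -> exists c, v = row b c.
    move=> vb; have /choice[a aP] : forall i, exists a : 'I_b.+1, v 0 i = a%:Z.
      by move=> i; have [a ab ->] := vb i; exists (Ordinal (ab : a < b.+1)%N).
    by exists (finfun a); apply/rowP => i; rewrite mxE ffunE ord1.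
  (* A pair encodes a set of generators with entries at most [m] and a target with entries at most
     [B]. The type is finite, so the number of summands can be maximised over it. *)
  pose FT : finType := ({set {ffun 'I_d -> 'I_m.+1}} * {ffun 'I_d -> 'I_B.+1})%type.
  pose set_of (p : FT) : set 'rV[int]_d :=
    [set row m c | c in [set c | c \in p.1]]%classic.
  have /choice[K KP] : forall p : FT, exists K : nat,
      lattice_generated (set_of p) (row B p.2) ->
      exists xs ys : seq 'rV[int]_d,
      [/\ forall x, x \in xs -> set_of p x, forall y, y \in ys -> set_of p y,
        row B p.2 = \sum_(x <- xs) x - \sum_(y <- ys) y & (size xs + size ys <= K)%N].
    move=> p; have [gen|ngen] := pselect (lattice_generated (set_of p) (row B p.2)).
      have [xs [ys [xsI ysI E]]] := lattice_generated_difference gen.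
      by exists (size xs + size ys)%N => _; exists xs, ys.
    by exists 0%N.
  exists (\max_p K p) => I v Im vB gen.
  have [c vc] := rowP _ _ vB.
  pose J := [set c : {ffun 'I_d -> 'I_m.+1} | `[< I (row m c) >]]%SET.
  have EI : I = set_of (J, c).
    apply/seteqP; split => u.
      by move=> Iu; have [e ue] := rowP _ _ (Im _ Iu); exists e => //=;
         rewrite inE -ue; apply/asboolP.
    by move=> [e /=]; rewrite inE => /asboolP Ie <-.
  rewrite EI vc in gen *.
  have [xs [ys [xsI ysI E sz]]] := KP (J, c) gen.
  exists xs, ys; split => //; apply: (leq_trans sz).
  exact: (leq_bigmax (J, c)).
have /choice[K KP] := fixed.
exists (\max_(d < dmax.+1) K d) => d I v dd Im vB gen.
have [xs [ys [xsI ysI E sz]]] := KP d I v Im vB gen.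
exists xs, ys; split => //; apply: (leq_trans sz).
exact: (leq_bigmax (Ordinal (dd : d < dmax.+1)%N)).
Qed.

(** * Degrees and almost perfect packings *)

Lemma exists_card_set (V : finType) l : (l <= #|V|)%N -> exists S : {set V}, #|S| = l.
Proof.
move=> lV; have : (0 < #|[set S : {set V} | #|S| == l]%SET|)%N.
  by rewrite card_draws bin_gt0.
by rewrite card_gt0 => /set0Pn[S]; rewrite inE => /eqP; exists S.
Qed.

Section Degrees.
Variables (k : nat) (V : finType) (H : kgraph k V).
Implicit Types (S T W : {set V}).

Lemma card_uniform_supersets S :
  (#|S| <= k)%N ->
  (#|[set e : {set V} | (#|e| == k) && (S \subset e)]%SET|
     <= 'C(#|V| - #|S|, k - #|S|))%N.
Proof.
move=> Sk; have -> : (#|V| - #|S|)%N = #|~: S|%SET by rewrite [RHS]cardsCs finset.setCK.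
rewrite -cards_draws.
pose B := [set A : {set V} | A \subset ~: S & #|A| == (k - #|S|)%N]%SET.
apply: (@leq_trans #|[set (S :|: A)%SET | A in B]%SET|); last first.
  exact: leq_imset_card.
apply/subset_leq_card/fintype.subsetP => e; rewrite inE => /andP[/eqP ek Se].
apply/imsetP; exists (e :\: S)%SET.
  by rewrite inE cardsDS // ek eqxx andbT finset.setDE finset.subsetIr.
by apply/setP => x; rewrite !inE; case: (boolP (x \in S)) => //= /(fintype.subsetP Se) ->.
Qed.

Lemma min_degree_le l S : #|S| = l -> (min_degree l H <= degree H S)%N.
Proof.
move=> Sl; rewrite /min_degree; elim: (index_enum _) (mem_index_enum S) => // T r IH.
rewrite inE big_cons => /predU1P[<-|/IH Sr]; first by rewrite Sl eqxx geq_minl.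
by case: ifP => // _; rewrite geq_min Sr orbT.
Qed.

Lemma le_min_degree l (a : nat) : (l <= #|V|)%N ->
  (forall S, #|S| = l -> (a <= degree H S)%N) -> (a <= min_degree l H)%N.
Proof.
move=> lV aS; have [S Sl] := exists_card_set lV.
rewrite /min_degree; apply: (big_ind (fun y => a <= y)%N) => [|x y ax ay|T /eqP Tl].
(* The initial value of the minimum, the number of edges, is at least the degree of some [l]-set;
   one exists because l <= |V|. *)
- apply: (leq_trans (aS S Sl)); apply/subset_leq_card/fintype.subsetP => e.
  by rewrite inE => /andP[].
- by rewrite leq_min ax.
- exact: aS.
Qed.

Lemma card_edge (e : {set V}) : e \in edges H -> #|e| = k.
Proof. by move/(fintype.subsetP (edges_uniform H)); rewrite inE => /eqP. Qed.

Lemma degree_le S : (#|S| <= k)%N -> (degree H S <= 'C(#|V| - #|S|, k - #|S|))%N.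
Proof.
move=> Sk; apply: leq_trans (card_uniform_supersets Sk).
apply/subset_leq_card/fintype.subsetP => e; rewrite !inE => /andP[eH ->].
by rewrite card_edge // eqxx.
Qed.

(** An edge containing [S] lies inside [W] or contains a vertex outside [W]; edges of the second
    kind are counted by that vertex. *)
Lemma degree_induced W (S : {set {x : V | x \in W}}) : (#|S| < k)%N ->
  (degree H (val @: S) <= degree (induced H W) S
     + #|~: W|%SET * 'C(#|V| - #|S|.+1, k - #|S|.+1))%N.
Proof.
move=> Sk; set S' := (val @: S)%SET.
have S'W x : x \in S' -> x \in W by move=> /imsetP[y _ ->]; exact: valP.
pose B := (\bigcup_(x in ~: W)
  [set e : {set V} | (#|e| == k) && ((x |: S') \subset e)])%SET.
pose G := [set (val @: (e : {set {x : V | x \in W}}))%SET |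
   e in [set e in edges (induced H W) | S \subset e]%SET]%SET.
apply: (@leq_trans #|G :|: B|%SET).
  apply/subset_leq_card/fintype.subsetP => e; rewrite inE => /andP[eH Se].
  rewrite inE; have [eW|] := boolP (e \subset W).
    apply/orP; left; apply/imsetP; exists (val @^-1: e)%SET.
      have ee : (val @: (val @^-1: e : {set {x : V | x \in W}}))%SET = e.
        apply/setP => x; apply/imsetP/idP => [[y + ->]|xe]; first by rewrite inE.
        by exists (Sub x (fintype.subsetP eW _ xe)) => //; rewrite inE SubK.
      rewrite !inE ee eH /=; apply/fintype.subsetP => y yS; rewrite inE.
      by apply: (fintype.subsetP Se); exact: imset_f.
    apply/setP => x; apply/idP/imsetP => [xe|[y + ->]]; last by rewrite inE.
    by exists (Sub x (fintype.subsetP eW _ xe)) => //; rewrite inE SubK.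
  move=> /fintype.subsetPn[x xe xW]; apply/orP; right; apply/bigcupP; exists x.
    by rewrite inE.
  by rewrite inE card_edge // eqxx finset.subUset finset.sub1set xe.
apply: (leq_trans (leq_card_setU _ _)); apply: leq_add; first exact: leq_imset_card.
apply: (leq_trans (leq_card_bigcup _ _)); rewrite -sum_nat_const.
apply: leq_sum => x; rewrite inE => xW.
have cS : #|x |: S'|%SET = #|S|.+1.
  rewrite cardsU1 (_ : x \notin S'); last by apply: contra xW; exact: S'W.
  by rewrite card_imset //; exact: val_inj.
by rewrite -cS; apply: card_uniform_supersets; rewrite cS.
Qed.

End Degrees.

Lemma min_degree_induced (k : nat) (V : finType) (H : kgraph k V) l (W : {set V}) :
  (l < k)%N -> (l <= #|W|)%N ->
  (min_degree l H <= min_degree l (induced H W)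
     + #|~: W|%SET * 'C(#|V| - l.+1, k - l.+1))%N.
Proof.
move=> lk lW; rewrite addnC -leq_subLR; apply: le_min_degree.
  by rewrite card_sig (eq_card (B := mem W)).
move=> S Sl; rewrite leq_subLR addnC -Sl; apply: leq_trans _ (degree_induced H _).
  by apply: min_degree_le; rewrite card_imset //; exact: val_inj.
by rewrite Sl.
Qed.

(** Deleting a small proportion of the vertices lowers the relative minimum degree only slightly, so
    the threshold still applies to the hypergraph induced on [W]. *)
Lemma packing_threshold_cover (R : realType) (k l : nat) (U : finType)
    (F : kgraph k U) (D : nat) (gamma : R) : (l < k)%N -> 0 < gamma ->
  exists (kappa : R) (n0 : nat), 0 < kappa /\
  forall (V : finType) (H : kgraph k V), (n0 <= #|V|)%N ->
    (packing_threshold R F l D + gamma) * 'C(#|V| - l, k - l)%:R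
      <= (min_degree l H)%:R ->
  forall W : {set V}, #|~: W|%SET%:R <= kappa * #|V|%:R ->
  exists M, [/\ packing F H M, covered M \subset W & (#|W :\: covered M| <= D)%N].
Proof.
move=> lk g0; rewrite /packing_threshold; set S := (X in inf X).
have Sinf : has_inf S.
  split; last by exists 0 => x [].
  exists 1; split => // eps e0; exists k => V H kV degH; exfalso.
  have lV : (l <= #|V|)%N by exact: leq_trans (ltnW lk) kV.
  have [A Al] := exists_card_set lV.
  have := leq_trans (min_degree_le H Al) (degree_le H _).
  rewrite Al => /(_ (ltnW lk)); rewrite -(ler_nat R) => mC.
  have := le_trans degH mC; rewrite -[leRHS]mul1r ler_pM2r; last first.
    by rewrite ltr0n bin_gt0 leq_sub2r.
  by rewrite gerDl leNgt e0.
(* Of the slack [gamma], one half pays for the excess of [delta] over the infimum, one quarter is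
   the [eps] used with [delta], and one quarter covers the degree lost outside [W]. *)
have [delta [d0 Sd] dS] := inf_adherent (divr_gt0 g0 (ltr0n R 2)) Sinf.
have [n1 n1P] := Sd _ (divr_gt0 g0 (ltr0n R 4)).
(* The bound 1/2 keeps half of the vertices in [W], hence at least [n1] and at least [l] of them;
   the other bound controls the loss of degree. *)
pose kappa : R := Num.min (1 / 2) (gamma / (8 * k%:R)).
have k0 : 0 < k%:R :> R by rewrite ltr0n (leq_ltn_trans _ lk).
exists kappa, (2 * (n1 + l) + 1)%N; split.
  by rewrite lt_min !divr_gt0 ?mulr_gt0.
move=> V H nV degH W Wk.
set n := #|V| in nV degH Wk *.
have Wn : (#|W| + #|~: W|%SET)%N = n by rewrite cardsC.
have nlV : (l < n)%N by lia.
have Whalf : (#|~: W|%SET * 2 <= n)%N.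
  rewrite -(ler_nat R) natrM; apply: (@le_trans _ _ (kappa * n%:R * 2)).
    by rewrite ler_wpM2r.
  rewrite -[leRHS]mul1r mulrAC ler_wpM2r ?ler0n //.
  by rewrite -ler_pdivlMr // ge_min lexx.
have n1W : (n1 <= #|W|)%N by lia.
have lW : (l <= #|W|)%N by lia.
have cW : #|[the finType of {x : V | x \in W}]| = #|W|.
  by rewrite card_sig; apply: eq_card.
(* After multiplication by n - l, the absorption identity for binomials turns the left side into |V
   \ W| (k - l) C(n-l, k-l). The choice of [kappa] and n <= 2(n - l) then give the bound. *)
have loss : (#|~: W|%SET * 'C(n - l.+1, k - l.+1))%:R
     <= gamma / 4 * 'C(n - l, k - l)%:R.
  have binE : ((n - l) * 'C(n - l.+1, k - l.+1) = (k - l) * 'C(n - l, k - l))%N.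
    have -> : (n - l.+1 = (n - l).-1)%N by lia.
    have -> : (k - l.+1 = (k - l).-1)%N by lia.
    have : (0 < k - l)%N by lia.
    have : (0 < n - l)%N by lia.
    case: (n - l)%N => // a _; case: (k - l)%N => // b _ /=.
    exact: mul_bin_diag.
  have nl0 : 0 < (n - l)%:R :> R by rewrite ltr0n subn_gt0.
  rewrite -(ler_pM2l nl0) -natrM mulnCA natrM binE natrM mulrA.
  rewrite [leRHS]mulrA ler_wpM2r ?ler0n //.
  apply: (@le_trans _ _ (kappa * n%:R * k%:R)).
    by apply: ler_pM; rewrite ?ler0n // ler_nat leq_subr.
  apply: (@le_trans _ _ (gamma / (8 * k%:R) * n%:R * k%:R)).
    by rewrite !ler_wpM2r ?ler0n // ge_min lexx orbT.
  have -> : gamma / (8 * k%:R) * n%:R * k%:R = gamma / 8 * n%:R.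
    by field; rewrite pnatr_eq0 -lt0n -(ltr0n R).
  have n2 : n%:R <= 2 * (n - l)%:R :> R by rewrite -natrM ler_nat; lia.
  have := ler_wpM2l (ltW (divr_gt0 g0 (ltr0n R 8))) n2.
  by move=> /le_trans; apply; rewrite le_eqVlt; apply/orP; left; apply/eqP; field.
have [] := n1P _ (induced H W).
- by rewrite cW.
- have := min_degree_induced H lk lW; rewrite -/n -(ler_nat R) natrD => mdW.
  rewrite cW; apply: (@le_trans _ _ ((delta + gamma / 4) * 'C(n - l, k - l)%:R)).
    rewrite ler_wpM2l ?addr_ge0 ?divr_ge0 ?(ltW g0) // ler_nat.
    by apply: leq_bin2l; rewrite leq_sub2r // -Wn leq_addr.
  have : (delta + gamma / 2) * 'C(n - l, k - l)%:R <= (min_degree l H)%:R.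
    apply: le_trans degH; rewrite ler_wpM2r ?ler0n //; lra.
  lra.
move=> M [pM DM]; have [N [pN cN]] := packing_of_induced pM.
exists N; split => //; rewrite cN.
  by apply/fintype.subsetP => _ /imsetP[x _ ->]; exact: valP.
apply: leq_trans DM; rewrite -(card_imset _ val_inj).
apply/subset_leq_card/fintype.subsetP => x; rewrite inE => /andP[xM xW].
apply/imsetP; exists (Sub x xW) => //; rewrite inE.
by apply: contra xM => xM; apply/imsetP; exists (Sub x xW).
Qed.

(** * Absorbers *)

Lemma ler_bool (R : realType) (b c : bool) : (b -> c) -> b%:R <= c%:R :> R.
Proof. by case: b => [->|_] //; rewrite ler_nat. Qed.

Section Absorbers.
Variables (R : realType) (k : nat) (U : finType) (F : kgraph k U).
Variables (V : finType) (H : kgraph k V) (d : nat) (P : 'I_d -> {set V}).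
Variables (beta mu rho : R) (t : nat).
Implicit Types (A E S X Y Z Phi : {set V}).
Local Notation m := #|U|.
Local Notation n := #|V|.

Hypotheses (n_gt0 : (0 < n)%N) (rho_gt0 : 0 < rho) (rho_le1 : rho <= 1).
Hypotheses (rho_beta : rho *+ 2 <= beta) (rho_mu : rho *+ 2 * m%:R ^+ m <= mu).
Hypothesis (partP : ordered_partition P).
Hypothesis (closedP : forall i, closed_in F beta t H (P i)).

Lemma common_part Z1 Z2 x : index_vector P Z1 = index_vector P Z2 -> x \in Z1 ->
  exists i y, [/\ x \in P i, y \in P i & y \in Z2].
Proof.
move=> Z12 xZ1; have [i xi _] := partition_index partP x.
have : (0 < #|Z2 :&: P i|%SET)%N.
  have /rowP/(_ i) := Z12; rewrite !mxE => -[<-].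
  by rewrite card_gt0; apply/set0Pn; exists x; rewrite inE xZ1.
by rewrite card_gt0 => /set0Pn[y]; rewrite inE => /andP[yZ2 yi]; exists i, y.
Qed.

Lemma index_vectorD1 Z x i : x \in Z -> x \in P i ->
  index_vector P (Z :\ x)%SET = index_vector P Z - delta_mx 0 i.
Proof.
move=> xZ xi; have [j xj uj] := partition_index partP x.
rewrite -{2}(setD1K xZ) index_vectorU; last first.
  by rewrite -setI_eq0; apply/eqP/setP => y; rewrite !inE; case: eqP.
rewrite [index_vector P [set x]%SET](_ : _ = delta_mx 0 i); first by rewrite addrAC subrr add0r.
apply/rowP => l; rewrite !mxE eqxx /=.
have [->|li] := eqVneq l i.
  by rewrite (setIidPl _) ?cards1 // finset.sub1set.
rewrite (_ : _ :&: _ = finset.set0)%SET ?cards0 //.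
apply/setP => y; rewrite !inE; apply/negP => /andP[/eqP -> xl].
by case/eqP: li; rewrite (uj _ xl) (uj _ xi).
Qed.

(** Reachability for sets: [A] serves [Z1] and [Z2] as a set [S] serves two reachable vertices.
    [Phi] collects the vertices already in use. *)
Definition connects Z1 Z2 Phi A : Prop :=
  [/\ packable F H (A :|: Z1)%SET, packable F H (A :|: Z2)%SET &
      [disjoint A & Z1 :|: Z2 :|: Phi]].

Definition absorbs Z Phi A : Prop :=
  [/\ packable F H A, packable F H (A :|: Z)%SET & [disjoint A & Z :|: Phi]].

Lemma card_vertex_connectors i x y Phi :
  x \in P i -> y \in P i -> x != y -> #|Phi|%:R <= rho * n%:R ->
  rho * n%:R ^+ (t * m - 1) <= #|[set S : {set V} | (#|S| == (t * m - 1)%N) &&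
     (`[< packable F H (x |: S)%SET /\ packable F H (y |: S)%SET >]
        && [disjoint S & Phi])]%SET|%:R.
Proof.
move=> xi yi xy Phin; apply: card_uniform_avoiding => //.
apply: le_trans (le_trans _ (closedP xi yi xy)) _.
  by rewrite ler_wpM2r // exprn_ge0.
rewrite ler_nat; apply/subset_leq_card/fintype.subsetP => S.
rewrite !inE => /andP[-> /asboolP[xS yS]] /=; apply/asboolP.
by split; exact: packable_of_induced.
Qed.

(** Equal index vectors allow the vertices of [Z1] and [Z2] to be matched within the parts. Each
    matched pair is joined by a random reachability set, at the cost of one factor [rho]. *)
Lemma avg_connects b Z1 Z2 Phi :
  [disjoint Z1 & Z2] -> #|Z1| = b -> index_vector P Z1 = index_vector P Z2 ->
  (#|Phi| + b * 2 + b * (t * m - 1))%:R <= rho * n%:R ->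
  rho ^+ b <= avg (b * (t * m - 1)) (fun A => `[< connects Z1 Z2 Phi A >]%:R).
Proof.
elim: b Z1 Z2 Phi => [|b IH] Z1 Z2 Phi Z12 Z1b iZ Phin.
  have Z10 : Z1 = finset.set0 by apply/eqP; rewrite -cards_eq0 Z1b.
  have Z20 : Z2 = finset.set0.
    apply/eqP; rewrite -cards_eq0 -eqz_nat -(sum_index_vector partP) -iZ.
    by rewrite (sum_index_vector partP) Z1b.
  rewrite /= expr0 (_ : `[< _ >]) //; apply/asboolP; rewrite Z10 Z20.
  by split; rewrite ?finset.setU0; [exact: packable0|exact: packable0|exact: disjoint_set0].
have [x xZ1] : exists x, x \in Z1 by apply/set0Pn; rewrite -card_gt0 Z1b.
have [i [y [xi yi yZ2]]] := common_part iZ xZ1.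
have xy : x != y.
  apply/eqP => E; move: Z12; rewrite -setI_eq0 => /set0Pn[].
  by exists x; rewrite inE xZ1 E.
have xZ2 : x \notin Z2 by rewrite (disjointFr Z12 xZ1).
have yZ1 : y \notin Z1 by rewrite (disjointFl Z12 yZ2).
have Z2b : #|Z2| = b.+1.
  apply/eqP; rewrite -eqz_nat -(sum_index_vector partP) -iZ.
  by rewrite (sum_index_vector partP) Z1b.
rewrite mulSn exprS; set s := (t * m - 1)%N in Phin *.
apply: (avg_extend (Q := fun S => `[< packable F H (x |: S)%SET /\
   packable F H (y |: S)%SET >] && [disjoint S & Z1 :|: Z2 :|: Phi]%SET)) => //.
- by rewrite exprn_ge0 // ltW.
- apply: (@card_vertex_connectors i) => //.
  apply: le_trans Phin; rewrite ler_nat.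
  have := (leq_card_setU (Z1 :|: Z2)%SET Phi).1; have := (leq_card_setU Z1 Z2).1.
  by rewrite Z1b Z2b; clear; lia.
move=> S Ss /andP[/asboolP[xS yS] SZ].
(* The forbidden set grows by at most 2 + (tm - 1) vertices, exactly what the terms in [b] of the
   size hypothesis release when [b] drops by one. *)
pose Phi' := (x |: (y |: (S :|: Phi)))%SET.
apply: le_trans (IH (Z1 :\ x)%SET (Z2 :\ y)%SET Phi' _ _ _ _) _.
- by apply: disjointWl (disjointWr _ Z12); exact: finset.subsetDl.
- by move/eqP: Z1b; rewrite (cardsD1 x) xZ1 eqSS => /eqP.
- by rewrite (index_vectorD1 xZ1 xi) (index_vectorD1 yZ2 yi) iZ.
- apply: le_trans Phin; rewrite ler_nat /Phi'.
  have := (leq_card_setU [set x]%SET (y |: (S :|: Phi))%SET).1.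
  have := (leq_card_setU [set y]%SET (S :|: Phi)%SET).1.
  have := (leq_card_setU S Phi).1.
  by rewrite !cards1 Ss mulSn -/s; clear; lia.
apply: le_avg => A _; apply: ler_bool => /asboolP[A1 A2 AZ].
apply/asboolP.
have dis z : z \in A -> [/\ z \notin Z1, z \notin Z2, z \notin S, z \notin Phi &
     (z != x) && (z != y)].
  move=> zA; have := disjointFr AZ zA; rewrite !inE.
  by case: eqP => //=; case: eqP => //= _ _; case: (z \in Z1); case: (z \in Z2);
     case: (z \in S); case: (z \in Phi).
have disS z : z \in S -> [/\ z \notin Z1, z \notin Z2 & z \notin Phi].
  move=> zS; have := disjointFr SZ zS; rewrite !inE.
  by case: (z \in Z1); case: (z \in Z2); case: (z \in Phi).
(* Used with [x] in [Z1] and with [y] in [Z2]: the first piece is packable by reachability, the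
   second by induction. *)
have split_off z Z : z \in Z -> (S :|: A :|: Z = (z |: S) :|: (A :|: (Z :\ z)))%SET.
  move=> zZ; apply/setP => w; rewrite !inE; case: (eqVneq w z) => [->|_] /=.
    by rewrite zZ !orbT.
  by rewrite orbA.
split.
- rewrite (split_off x) //; apply: packableU => //.
  rewrite -setI_eq0; apply/eqP/setP => w; rewrite !inE.
  apply/negP => /andP[/orP[/eqP ->|wS] /orP[/dis[w1 _ wS' _ wx]|/andP[wx wZ]]].
  + by rewrite eqxx in wx.
  + by rewrite eqxx in wx.
  + by rewrite wS in wS'.
  + by have [] := disS w wS; rewrite wZ.
- rewrite (split_off y) //; apply: packableU => //.
  rewrite -setI_eq0; apply/eqP/setP => w; rewrite !inE.
  apply/negP => /andP[/orP[/eqP ->|wS] /orP[/dis[w1 _ wS' _ wx]|/andP[wx wZ]]].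
  + by rewrite eqxx andbF in wx.
  + by rewrite eqxx in wx.
  + by rewrite wS in wS'.
  + by have [] := disS w wS; rewrite wZ.
rewrite -setI_eq0; apply/eqP/setP => w; rewrite !inE.
apply/negP => /andP[/orP[/disS[/negbTE -> /negbTE -> /negbTE ->] //|]].
by case/dis => /negbTE -> /negbTE -> _ /negbTE ->.
Qed.

(** Passing from copies to their vertex sets costs the factor m^m of [rho_mu], and avoiding [Phi]
    costs its factor 2. *)
Lemma card_robust_copies x Phi : robust_index_vectors mu P F H x ->
  #|Phi|%:R <= rho * n%:R ->
  rho * n%:R ^+ m <= #|[set E : {set V} | (#|E| == m) &&
    (((index_vector P E == x) && [exists C in copies F H, C.1 == E])
       && [disjoint E & Phi])]%SET|%:R.
Proof.
move=> xI Phin; apply: card_uniform_avoiding => //.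
have m0 : 0 < m%:R ^+ m :> R.
  case: (posnP m) => [->|m0]; first by rewrite expr0.
  by rewrite exprn_gt0 // ltr0n.
rewrite -(ler_pM2r m0) mulrAC; apply: (@le_trans _ _ (mu * n%:R ^+ m)).
  by rewrite ler_wpM2r // exprn_ge0.
apply: le_trans xI _; rewrite -natrX -natrM ler_nat.
exact: (card_copies_le F H (fun E => index_vector P E == x)).
Qed.

(** The copies are drawn one at a time, each avoiding [Phi] and its predecessors. The last
    hypothesis is the continuation of the construction, so that two such selections and a connector
    can be nested. *)
Lemma avg_robust_copies xs Phi T (f : {set V} -> R) b :
  (forall A, 0 <= f A) -> 0 <= b ->
  (forall x, x \in xs -> robust_index_vectors mu P F H x) ->
  (#|Phi| + m * size xs)%:R <= rho * n%:R ->
  (forall X, packable F H X -> index_vector P X = \sum_(x <- xs) x ->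
     [disjoint X & Phi] -> #|X| = (m * size xs)%N ->
     b <= avg T (fun A => f (X :|: A)%SET)) ->
  rho ^+ size xs * b <= avg (m * size xs + T) f.
Proof.
elim: xs Phi f => [|x xs IH] Phi f f0 b0 xsI Phin fb.
  rewrite /= muln0 expr0 mul1r add0n.
  apply: le_trans (fb finset.set0 _ _ _ _) _.
  - exact: packable0.
  - by rewrite big_nil index_vector0.
  - exact: disjoint_set0.
  - by rewrite cards0 muln0.
  by apply: le_avg => A _; rewrite set0U.
rewrite [size _]/= mulnS -addnA exprS -mulrA.
apply: (avg_extend (Q := fun E => ((index_vector P E == x) &&
   [exists C in copies F H, C.1 == E]) && [disjoint E & Phi])) => //.
- by rewrite mulr_ge0 // exprn_ge0 // ltW.
- apply: card_robust_copies; first by apply: xsI; rewrite inE eqxx.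
  by apply: le_trans Phin; rewrite ler_nat leq_addr.
move=> E Em /andP[/andP[/eqP Ex /existsP[C /andP[CH /eqP CE]]] EPhi].
apply: (IH (E :|: Phi)%SET) => //.
- by move=> y yxs; apply: xsI; rewrite inE yxs orbT.
- apply: le_trans Phin; rewrite ler_nat /= mulnS.
  by rewrite addnA leq_add2r addnC -Em (leq_card_setU E Phi).1.
move=> X pX iX dX cX.
have EX : [disjoint E & X].
  by rewrite disjoint_sym; apply: disjointWr dX; exact: finset.subsetUl.
rewrite (@eq_avg _ _ T _ (fun A => f ((E :|: X) :|: A)%SET)); last first.
  by move=> A; rewrite setUA.
apply: fb.
- by apply: packableU => //; rewrite -CE; exact: packable_copy.
- by rewrite index_vectorU // Ex iX big_cons.
- rewrite -setI_eq0 setIUl finset.setU_eq0 !setI_eq0 EPhi.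
  by apply: disjointWr dX; exact: finset.subsetUr.
- by rewrite cardsU (disjoint_setI0 EX) cards0 subn0 Em cX mulnS.
Qed.

(* Y realises ys and X realises xs, so X and Y :|: Z have the same index vector;
   A is a connector of X and Y :|: Z together with X and Y. *)
Lemma avg_absorbs xs ys K Z Phi :
  (forall x, x \in xs -> robust_index_vectors mu P F H x) ->
  (forall y, y \in ys -> robust_index_vectors mu P F H y) ->
  index_vector P Z = \sum_(x <- xs) x - \sum_(y <- ys) y ->
  (size xs + size ys <= K)%N ->
  (#|Phi| + #|Z| + m * K * (t * m + 4))%:R <= rho * n%:R ->
  exists2 T, (T <= m * K * (t * m + 4))%N &
    rho ^+ (K + m * K) <= avg T (fun A => `[< absorbs Z Phi A >]%:R).
Proof.
move=> xsI ysI iZ sK Phin.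
set p := size xs in sK *; set r := size ys in sK *; set s := (t * m - 1)%N.
have [mK msK Kdef] : [/\ m * r + m * p <= m * K, m * p * s <= m * K * (t * m) &
    m * K * (t * m + 4) = m * K * (t * m) + 4 * (m * K)]%N.
  split; first by rewrite -mulnDr leq_mul2l addnC sK orbT.
    by rewrite leq_mul ?leq_subr // leq_mul2l (leq_trans (leq_addr r p) sK) orbT.
  by rewrite mulnDr [(4 * _)%N]mulnC.
(* These are the vertices of [Y], of [X] and of the connector. The density has one factor [rho] for
   each of the r + p copies and one for each of the mp matched pairs. *)
exists (m * r + (m * p + (m * p) * s))%N; first by rewrite Kdef; clear -mK msK; lia.
apply: (@le_trans _ _ (rho ^+ r * (rho ^+ p * rho ^+ (m * p)))).
  rewrite -!exprD; apply: ler_wiXn2l => //; first exact: ltW.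
  by clear -sK mK; lia.
have f0 A : 0 <= `[< absorbs Z Phi A >]%:R :> R by [].
have bound j : (j <= #|Phi| + #|Z| + (m * K * (t * m) + 4 * (m * K)))%N -> j%:R <= rho * n%:R.
  by move=> jle; apply: le_trans Phin; rewrite ler_nat Kdef.
apply: (@avg_robust_copies ys (Z :|: Phi)%SET) => //.
- by rewrite mulr_ge0 // exprn_ge0 // ltW.
- apply: bound; have := (leq_card_setU Z Phi).1; rewrite -/r; clear -mK msK; lia.
move=> Y pY iY dY cY.
apply: (@avg_robust_copies xs (Y :|: (Z :|: Phi))%SET) => //.
- by rewrite exprn_ge0 // ltW.
- apply: bound; have := (leq_card_setU Z Phi).1.
  have := (leq_card_setU Y (Z :|: Phi)%SET).1; rewrite cY -/r -/p; clear -mK msK; lia.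
move=> X pX iX dX cX.
have YZ : [disjoint Y & Z] by apply: disjointWr dY; exact: finset.subsetUl.
have XYZ : [disjoint X & Y :|: Z].
  by apply: disjointWr dX; rewrite setUA finset.subsetUl.
apply: (le_trans (@avg_connects _ X (Y :|: Z)%SET Phi _ cX _ _)) => //.
- by rewrite index_vectorU // iX iY iZ addrC subrK.
- by apply: bound; rewrite -/p -/s; clear -mK msK; lia.
apply: le_avg => A _; apply: ler_bool => /asboolP[A1 A2 dA]; apply/asboolP.
have dAX : [disjoint A & X].
  by apply: disjointWr dA; rewrite -setUA finset.subsetUl.
have dAY : [disjoint A & Y].
  apply: disjointWr dA; apply: fintype.subset_trans (finset.subsetUl _ _).
  by apply: fintype.subset_trans (finset.subsetUr _ _); exact: finset.subsetUl.
have dAZ : [disjoint A & Z].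
  apply: disjointWr dA; apply: fintype.subset_trans (finset.subsetUl _ _).
  by apply: fintype.subset_trans (finset.subsetUr _ _); exact: finset.subsetUr.
have dAPhi : [disjoint A & Phi] by apply: disjointWr dA; exact: finset.subsetUr.
have dXY : [disjoint X & Y] by apply: disjointWr XYZ; exact: finset.subsetUl.
have dXZPhi : [disjoint X & Z :|: Phi] by apply: disjointWr dX; exact: finset.subsetUr.
(* Alone, the absorber is packed as [A :|: X] together with [Y]; with [Z] added, as
   [A :|: (Y :|: Z)] together with [X]. *)
split.
- apply: packableU => //; first by rewrite finset.setUC.
  by rewrite disjoint_sym -setI_eq0 setIUl finset.setU_eq0 !setI_eq0 dXY.
- have -> : (Y :|: (X :|: A) :|: Z = (A :|: (Y :|: Z)) :|: X)%SET.
    by apply/setP => w; rewrite !inE; case: (w \in A); case: (w \in X);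
       case: (w \in Y); case: (w \in Z).
  apply: packableU => //.
  by rewrite -setI_eq0 setIUl finset.setU_eq0 !setI_eq0 dAX disjoint_sym.
- rewrite -setI_eq0 !setIUl !finset.setU_eq0 !setI_eq0 dY dXZPhi /=.
  by rewrite -setI_eq0 setIUr finset.setU_eq0 !setI_eq0 dAZ.
Qed.
End Absorbers.

(** * Greedy choice of absorbers *)

Section GreedyAbsorption.
Variables (R : realType) (k : nat) (U : finType) (F : kgraph k U).
Variables (V : finType) (H : kgraph k V).
Variables (targets : {set {set V}}) (Phi : {set V}) (Tmax : nat) (eta kappa : R).
Implicit Types (A Z : {set V}) (M N : {set subgraph V}).

Hypotheses (eta_gt0 : 0 < eta) (eta_le1 : eta <= 1).
Hypothesis rich : forall Z (Psi : {set V}), Z \in targets ->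
  #|Psi|%:R <= kappa * #|V|%:R ->
  exists2 T, (T <= Tmax)%N & eta <= avg T (fun A => `[< absorbs F H Z Psi A >]%:R).

(** The set [Z] may meet [covered M]; only the subpacking that absorbs it has to avoid it. *)
Definition absorbable M Z : Prop := exists N,
  [/\ N \subset M, [disjoint covered N & Z] & packable F H (covered N :|: Z)%SET].

Definition unabsorbed M : {set {set V}} :=
  [set Z in targets | ~~ `[< absorbable M Z >]]%SET.

Lemma unabsorbed_sub M N : M \subset N -> unabsorbed N \subset unabsorbed M.
Proof.
move=> MN; apply/fintype.subsetP => Z; rewrite !inE => /andP[-> /=].
apply: contra => /asboolP[N' [N'M dZ pZ]]; apply/asboolP; exists N'.
by split => //; exact: fintype.subset_trans MN.
Qed.

(** Double counting of pairs of a random set and a target that it absorbs: some set does at least as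
    well as the average. *)
Lemma popular_absorber (Psi : {set V}) (S : {set {set V}}) : S \subset targets ->
  #|Psi|%:R <= kappa * #|V|%:R ->
  exists A, (#|A| <= Tmax)%N /\
    eta / Tmax.+1%:R * #|S|%:R <=
      #|[set Z in S | `[< absorbs F H Z Psi A >]]%SET|%:R.
Proof.
move=> ST Psin.
pose hit A Z := (#|A| <= Tmax)%N && `[< absorbs F H Z Psi A >].
pose g A : R := \sum_(Z in S) (hit A Z)%:R.
pose A := [arg max_(A > (@finset.set0 V)) g A]%O.
have gA B : g B <= g A.
  by rewrite /A; case: arg_maxP => // C _; exact.
(* The number [T] of random vertices depends on the target, so the averages for all T <= Tmax are
   added; this costs the factor [Tmax.+1]. *)
have gE : eta * #|S|%:R <= Tmax.+1%:R * g A.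
  apply: (@le_trans _ _ (\sum_(T < Tmax.+1) avg T g)); last first.
    apply: (@le_trans _ _ (\sum_(T < Tmax.+1) g A)).
      apply: ler_sum => T _; apply: avg_le_bound => //.
      by apply: sumr_ge0.
    by rewrite sumr_const card_ord mulr_natl.
  rewrite (eq_bigr (fun T : 'I_Tmax.+1 => \sum_(Z in S) avg T (fun A => (hit A Z)%:R))).
    rewrite exchange_big /= mulr_natr -sumr_const; apply: ler_sum => Z ZS.
    have [T TT eT] := rich (fintype.subsetP ST _ ZS) Psin.
    have TT' : (T < Tmax.+1)%N by [].
    rewrite (bigD1 (Ordinal TT')) //= -[eta]addr0; apply: lerD.
      apply: (le_trans eT); apply: le_avg => B BT; apply: ler_bool => BZ.
      by rewrite /hit BZ (leq_trans BT).
    by apply: sumr_ge0 => i _; apply: avg_ge0.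
  by move=> T _; exact: avg_sum.
(* Empty [S] is treated apart, because the bound on |A| below rests on [0 < g A]: sets larger than
   [Tmax] score 0. *)
have [S0|S0] := posnP #|S|.
  by exists finset.set0; rewrite cards0 S0 mulr0.
have gApos : 0 < g A.
  by rewrite -(pmulr_rgt0 _ (ltr0n R Tmax.+1)) (lt_le_trans _ gE) // mulr_gt0 ?ltr0n.
have AT : (#|A| <= Tmax)%N.
  rewrite leqNgt; apply/negP => TA; move: gApos; rewrite /g big1 ?ltxx // => Z _.
  by rewrite /hit leqNgt TA.
exists A; split => //; rewrite mulrAC ler_pdivrMr ?ltr0n //; apply: (le_trans gE).
rewrite mulrC ler_wpM2r ?ler0n // /g -natr_sum ler_nat.
rewrite -sum1_card [X in (X <= _)%N]big_mkcond [X in (_ <= X)%N]big_mkcond /=.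
by apply: leq_sum => Z _; rewrite inE /hit AT; case: (Z \in S); case: `[< _ >].
Qed.

(** A popular absorber, chosen away from [covered M] and [Phi], is joined to [M]; the targets that
    it absorbs leave the unabsorbed family. *)
Lemma greedy_step M : packing F H M -> [disjoint covered M & Phi] ->
  #|covered M :|: Phi|%SET%:R <= kappa * #|V|%:R ->
  exists N, [/\ packing F H N, [disjoint covered N & Phi],
    (#|covered N| <= #|covered M| + Tmax)%N &
    #|unabsorbed N|%:R <= (1 - eta / Tmax.+1%:R) * #|unabsorbed M|%:R].
Proof.
move=> pM dM Mn; set S := unabsorbed M.
have [S0|S0] := posnP #|S|.
  by exists M; rewrite -/S S0 mulr0 leq_addr; split.
have ST : S \subset targets by apply/fintype.subsetP => Z; rewrite inE => /andP[].
have [A [AT hitA]] := popular_absorber ST Mn.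
set S' := [set Z in S | _]%SET in hitA.
(* One absorbed target suffices to certify that [A] is packable and avoids [covered M] and [Phi]. *)
have [Z ZS'] : exists Z, Z \in S'.
  apply/set0Pn; rewrite -card_gt0 -(ltr0n R); apply: lt_le_trans hitA.
  by rewrite mulr_gt0 ?divr_gt0 ?ltr0n.
have [pA dA] : packable F H A /\ [disjoint A & covered M :|: Phi].
  move: ZS'; rewrite inE => /andP[_ /asboolP[pA _ dA]]; split => //.
  by apply: disjointWr dA; exact: finset.subsetUr.
have [MA [pMA cMA]] := pA.
have dAM : [disjoint covered M & covered MA].
  by rewrite cMA disjoint_sym; apply: disjointWr dA; exact: finset.subsetUl.
exists (M :|: MA)%SET; split; first exact: packingU.
- rewrite coveredU -setI_eq0 setIUl finset.setU_eq0 !setI_eq0 dM cMA.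
  by apply: disjointWr dA; exact: finset.subsetUr.
- by rewrite coveredU cMA (leq_trans (leq_card_setU _ _)) // leq_add2l.
have S'S : S' \subset S by apply/fintype.subsetP => Y; rewrite inE => /andP[].
have US : unabsorbed (M :|: MA)%SET \subset (S :\: S')%SET.
  apply/fintype.subsetP => Y YU; rewrite inE.
  rewrite (fintype.subsetP (unabsorbed_sub (finset.subsetUl _ _)) _ YU) andbT.
  move: YU; rewrite inE => /andP[_]; apply: contra; rewrite inE => /andP[_].
  move=> /asboolP[_ pAY dAY]; apply/asboolP; exists MA; rewrite cMA finset.subsetUr.
  by split => //; apply: disjointWr dAY; exact: finset.subsetUl.
rewrite mulrBl mul1r lerBrDr; apply: (@le_trans _ _ (#|(S :\: S')%SET| + #|S'|)%:R).
  by rewrite natrD; apply: lerD => //; rewrite ler_nat subset_leq_card.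
by rewrite cardsDS // subnK // subset_leq_card.
Qed.

(** After [J] greedy steps fewer than one target is unabsorbed, hence none. *)
Lemma greedy_absorption J :
  (#|Phi| + J * Tmax)%:R <= kappa * #|V|%:R ->
  (1 - eta / Tmax.+1%:R) ^+ J * #|targets|%:R < 1 ->
  exists M, [/\ packing F H M, [disjoint covered M & Phi],
    (#|covered M| <= J * Tmax)%N & forall Z, Z \in targets -> absorbable M Z].
Proof.
move=> Jn small; set theta := 1 - _ in small.
have theta0 : 0 <= theta.
  rewrite subr_ge0 ler_pdivrMr ?ltr0n // mul1r (le_trans eta_le1) //.
  by rewrite ler1n.
suff [M [pM dM cM uM]] : exists M, [/\ packing F H M, [disjoint covered M & Phi],
    (#|covered M| <= J * Tmax)%N & #|unabsorbed M|%:R <= theta ^+ J * #|targets|%:R].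
  exists M; split => // Z ZT; have := le_lt_trans uM small.
  rewrite (ltr_nat R _ 1) ltnS leqn0 cards_eq0 => /eqP/setP/(_ Z).
  by rewrite !inE ZT /= => /negbFE/asboolP.
elim: J Jn {small} => [|J IH] Jn.
  exists finset.set0; rewrite covered0 cards0 expr0 mul1r; split => //.
  - exact: packing0.
  - exact: disjoint_set0.
  - by rewrite ler_nat subset_leq_card //; apply/fintype.subsetP => Z; rewrite inE => /andP[].
have [|M [pM dM cM uM]] := IH.
  by apply: le_trans Jn; rewrite ler_nat leq_add2l leq_mul2r leqnSn orbT.
have [|N [pN dN cN uN]] := greedy_step pM dM.
  apply: le_trans Jn; rewrite ler_nat mulSn.
  by apply: (leq_trans (leq_card_setU _ _)); clear -cM; lia.
exists N; split => //; first by clear -cN cM; rewrite mulSn; lia.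
by apply: (le_trans uN); rewrite exprS -mulrA ler_wpM2l.
Qed.
End GreedyAbsorption.

(** A number of steps that is a small multiple of n beats the polynomial number of targets. With y =
    (1 - theta)^(n/q), rounded down in the exponent, y (n+1) stays below a constant w; its power B +
    1 is then less than n + 1 for large n. *)
Lemma geometric_decay (R : realType) (theta kappa : R) (B : nat) :
  0 < theta -> theta <= 1 -> 0 < kappa ->
  exists n0, forall n, (n0 <= n)%N -> exists J : nat,
    J%:R <= kappa * n%:R /\ (1 - theta) ^+ J * (n.+1 ^ B)%:R < 1.
Proof.
move=> t0 t1 k0.
have arch (x : R) : exists N : nat, (0 < N)%N /\ x <= N%:R.
  by exists (Num.truncn x).+1; split => //; exact: ltW (truncnS_gt _).
(* A Bernoulli-type bound: geometric decay is at least as fast as 1/(1 + j theta). *)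
have decay j : (1 - theta) ^+ j * (1 + j%:R * theta) <= 1.
  elim: j => [|j IH]; first by rewrite mul0r addr0 mulr1.
  apply: le_trans IH; rewrite exprSr -mulrA ler_wpM2l ?exprn_ge0 ?subr_ge0 //.
  rewrite -natr1; have := mulr_ge0 (ler0n R j) (sqr_ge0 theta).
  have := sqr_ge0 theta; rewrite expr2; nra.
have [q [q0 qk]] := arch (B.+1%:R / kappa).
have [w [w0 wq]] := arch (2 * q%:R / theta).
exists (w ^ B.+1)%N => n nw.
exists (B.+1 * (n %/ q))%N; split.
  rewrite ler_pdivrMr // in qk.
  have h1 : (n %/ q * q)%:R <= n%:R :> R by rewrite ler_nat leq_divM.
  rewrite natrM in h1 *.
  have q0R : 0 < q%:R :> R by rewrite ltr0n.
  have := ler_wpM2r (ler0n R (n %/ q)) qk.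
  have := ler_wpM2l (ltW k0) h1; nra.
set j := (n %/ q)%N.
rewrite mulnC exprM; set y := (1 - theta) ^+ j.
have y0 : 0 <= y by rewrite exprn_ge0 // subr_ge0.
have yj : y * n.+1%:R <= w%:R.
  have nq : (n.+1 <= q * j.+1)%N by rewrite mulnC ltn_ceil.
  have jt : y * (j.+1%:R * theta) <= 1.
    apply: le_trans (decay j); rewrite ler_wpM2l // -natr1 mulrDl mul1r addrC.
    by rewrite lerD2r.
  have q0R : 0 < q%:R :> R by rewrite ltr0n.
  apply: (@le_trans _ _ (q%:R / theta)).
    rewrite ler_pdivlMr //.
    have h : y * n.+1%:R * theta <= y * (q * j.+1)%:R * theta.
      by rewrite ler_wpM2r ?ler_wpM2l ?ler_nat // ltW.
    apply: (le_trans h); rewrite natrM.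
    have := ler_wpM2l (ltW q0R) jt; rewrite mulr1.
    by apply: le_trans; rewrite le_eqVlt; apply/orP; left; apply/eqP; ring.
  apply: le_trans wq; rewrite ler_pM2r ?invr_gt0 // ler_peMl ?ler0n //.
  by rewrite ler1n.
have n0 : 0 < n.+1%:R :> R by rewrite ltr0n.
(* Multiplying by n + 1 gives [y] and n + 1 the same exponent B + 1. *)
rewrite -(ltr_pM2r n0) mul1r -mulrA -natrM -expnSr natrX -exprMn.
apply: (@le_lt_trans _ _ (w%:R ^+ B.+1)).
  by apply: lerXn2r; rewrite ?nnegrE ?mulr_ge0 ?ler0n.
by rewrite -natrX ltr_nat ltnS.
Qed.

(** Such a set is listed by a map from ['I_B] to [option V], with [None] as padding. *)
Lemma card_small_sets (V : finType) (B : nat) :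
  (#|[set Z : {set V} | (#|Z| <= B)%N]%SET| <= #|V|.+1 ^ B)%N.
Proof.
pose im (f : {ffun 'I_B -> option V}) : {set V} :=
  [set v | [exists i, f i == Some v]]%SET.
apply: (@leq_trans #|[set im f | f : {ffun 'I_B -> option V}]%SET|); last first.
  by apply: (leq_trans (leq_imset_card _ _)); rewrite card_ffun card_option card_ord.
apply/subset_leq_card/fintype.subsetP => Z; rewrite inE => ZB.
apply/imsetP; exists [ffun i : 'I_B => onth (enum Z) i] => //.
apply/setP => v; rewrite inE; apply/idP/existsP => [vZ|[i]].
  have vi : (index v (enum Z) < B)%N.
    by apply: leq_trans ZB; rewrite cardE index_mem mem_enum.
  exists (Ordinal vi); rewrite ffunE /=; apply/eqP.
  by rewrite onthE (nth_map v) ?nth_index ?index_mem ?mem_enum.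
rewrite ffunE => /eqP E.
have : v \in enum Z by apply/onthP; exists i.
by rewrite mem_enum.
Qed.

(** * Perfect packings *)

Lemma index_vector_bounded (V : finType) d (P : 'I_d -> {set V}) (S : {set V}) B :
  (#|S| <= B)%N -> bounded_row B (index_vector P S).
Proof.
move=> SB i; exists #|S :&: P i|%SET; last by rewrite mxE.
by apply: leq_trans SB; apply/subset_leq_card/finset.subsetIl.
Qed.

(** Disjoint parts of size at least cn number at most 1/c. As this is uniform in [H], one constant
    from [lattice_generated_bound] serves all partitions. *)
Lemma good_partition_parts (R : realType) (k : nat) (U : finType) (F : kgraph k U)
    (beta c : R) (t : nat) (V : finType) (H : kgraph k V) d (P : 'I_d -> {set V}) :
  (0 < #|V|)%N -> 0 < c -> good_partition F beta t c H P -> d%:R <= c^-1.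
Proof.
move=> V0 c0 [partP closedP]; rewrite -(ler_pM2r (_ : 0 < c * #|V|%:R)); last first.
  by rewrite mulr_gt0 // ltr0n.
rewrite [leRHS]mulrA mulVf ?gt_eqF // mul1r -{2}(sum_card_parts partP) natr_sum.
rewrite -[X in X%:R * _]card_ord mulr_natl -sumr_const.
by apply: ler_sum => i _; case: (closedP i).
Qed.

(** The greedy argument is run on the sets [Z] of at most [B] vertices with index vector in the
    lattice: each has absorbers of density [eta], and there are only polynomially many. *)
Lemma absorbing_packing (R : realType) (k : nat) (U : finType) (F : kgraph k U)
    (beta mu c kappa : R) (t B s : nat) :
  (0 < #|U|)%N -> 0 < beta -> 0 < mu -> 0 < c -> 0 < kappa ->
  exists n0, forall (V : finType) (H : kgraph k V), (n0 <= #|V|)%N ->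
    forall d (P : 'I_d -> {set V}), good_partition F beta t c H P ->
    forall Phi : {set V}, (#|Phi| <= s)%N ->
    exists M, [/\ packing F H M, [disjoint covered M & Phi],
      (#|covered M| + #|Phi|)%:R <= kappa * #|V|%:R &
      forall Z : {set V}, (#|Z| <= B)%N ->
        robust_lattice mu P F H (index_vector P Z) -> absorbable F H M Z].
Proof.
move=> m0 beta0 mu0 c0 kappa0; set m := #|U|.
have [K KP] := lattice_generated_bound (Num.truncn c^-1) m B.
have mm0 : 0 < m%:R ^+ m :> R by rewrite exprn_gt0 // ltr0n.
(* A common lower bound for the densities of connectors and of copies, after those meeting a small
   forbidden set are discarded. *)
pose rho : R := Num.min 1 (Num.min (beta / 2) (mu / (2 * m%:R ^+ m))).
have rho0 : 0 < rho by rewrite !lt_min ltr01 !divr_gt0 ?mulr_gt0.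
have rho1 : rho <= 1 by rewrite ge_min lexx.
have rhob : rho *+ 2 <= beta.
  by rewrite -mulr_natr -ler_pdivlMr // !ge_min lexx orbT.
have rhom : rho *+ 2 * m%:R ^+ m <= mu.
  by rewrite -[rho *+ 2]mulr_natr -mulrA -ler_pdivlMr ?mulr_gt0 // !ge_min lexx !orbT.
pose Tmax := (m * K * (t * m + 4))%N.
pose eta := rho ^+ (K + m * K).
have eta0 : 0 < eta by rewrite exprn_gt0.
have eta1 : eta <= 1 by rewrite exprn_ile1 // ltW.
(* The bound rho/2 leaves the other half of [rho] for [Z] and the absorber itself. *)
pose kap : R := Num.min kappa (rho / 2).
have kap0 : 0 < kap by rewrite lt_min kappa0 divr_gt0.
(* This fraction makes [J * Tmax] at most half of [kap * n]; the other half is left for [Phi]. *)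
have [n1 n1P] := @geometric_decay R (eta / Tmax.+1%:R) (kap / (2 * Tmax.+1%:R)) B
  ltac:(by rewrite divr_gt0 ?ltr0n)
  ltac:(by rewrite ler_pdivrMr ?ltr0n // mul1r (le_trans eta1) // ler1n)
  ltac:(by rewrite divr_gt0 ?mulr_gt0 ?ltr0n).
pose n2 := (Num.truncn (2 * (B + Tmax)%:R / rho)).+1.
pose n3 := (Num.truncn (2 * s%:R / kap)).+1.
exists (n1 + n2 + n3)%N => V H nV d P goodP Phi Phis.
have ln1 : (n1 <= #|V|)%N by apply: leq_trans nV; rewrite -addnA leq_addr.
have V0 : (0 < #|V|)%N by apply: leq_trans nV; rewrite /n3 addnS.
have big2 : (B + Tmax)%:R <= rho / 2 * #|V|%:R.
  have : 2 * (B + Tmax)%:R / rho <= #|V|%:R.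
    apply: le_trans (ltW (truncnS_gt _)) _; rewrite ler_nat.
    by apply: leq_trans nV; rewrite -/n2 addnAC leq_addl.
  by rewrite ler_pdivrMr // => h; lra.
have big3 : s%:R <= kap / 2 * #|V|%:R.
  have : 2 * s%:R / kap <= #|V|%:R.
    apply: le_trans (ltW (truncnS_gt _)) _; rewrite ler_nat.
    by apply: leq_trans nV; rewrite -/n3 leq_addl.
  by rewrite ler_pdivrMr // => h; lra.
have dK : (d <= Num.truncn c^-1)%N.
  rewrite truncn_ge_nat; first exact: good_partition_parts goodP.
  by rewrite invr_ge0 ltW.
have [partP closeP] := goodP.
have closedP i : closed_in F beta t H (P i) by case: (closeP i).
pose targets := [set Z : {set V} | (#|Z| <= B)%N &&
   `[< robust_lattice mu P F H (index_vector P Z) >]]%SET.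
have rich (Z Psi : {set V}) : Z \in targets -> #|Psi|%:R <= kap * #|V|%:R ->
  exists2 T, (T <= Tmax)%N & eta <= avg T (fun A => `[< absorbs F H Z Psi A >]%:R).
  rewrite inE => /andP[ZB /asboolP LZ] Psin.
  (* Since mu > 0, a robust index vector is realised by an actual copy, which has [m] vertices. *)
  have Im u : robust_index_vectors mu P F H u -> bounded_row m u.
    move=> uI; have : (0 < #|[set C in copies F H | index_vector P C.1 == u]%SET|)%N.
      by rewrite -(ltr0n R) (lt_le_trans _ uI) // mulr_gt0 // exprn_gt0 // ltr0n.
    rewrite card_gt0 => /set0Pn[C]; rewrite inE => /andP[CH /eqP <-].
    by apply: index_vector_bounded; rewrite (card_copy CH).
  have [xs [ys [xsI ysI iZ sK]]] := KP d _ _ dK Im (index_vector_bounded P ZB) LZ.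
  apply: (avg_absorbs (mu := mu) (beta := beta) (P := P) _ _ _ _ _ _ _ xsI ysI) => //.
  rewrite -/m -/Tmax -addnA natrD.
  have zn : (#|Z| + Tmax)%:R <= rho / 2 * #|V|%:R.
    by apply: le_trans big2; rewrite ler_nat leq_add2r.
  have pn : #|Psi|%:R <= rho / 2 * #|V|%:R.
    by apply: (le_trans Psin); rewrite ler_wpM2r ?ler0n // ge_min lexx orbT.
  lra.
have [J [JV Jsmall]] := n1P _ ln1.
have JT : (J * Tmax)%:R <= kap / 2 * #|V|%:R.
  rewrite natrM; apply: (@le_trans _ _ (J%:R * Tmax.+1%:R)).
    by rewrite ler_wpM2l ?ler_nat.
  apply: le_trans (ler_wpM2r (ler0n R Tmax.+1) JV) _.
  rewrite le_eqVlt; apply/orP; left; apply/eqP.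
  by field; rewrite nat1r pnatr_eq0.
have PhiJ : (#|Phi| + J * Tmax)%:R <= kap * #|V|%:R.
  have Phis' : #|Phi|%:R <= s%:R :> R by rewrite ler_nat.
  by rewrite natrD; lra.
have [|M [pM dM cM aM]] := greedy_absorption eta0 eta1 rich PhiJ.
  apply: le_lt_trans Jsmall; apply: ler_wpM2l.
    rewrite exprn_ge0 // subr_ge0 ler_pdivrMr ?ltr0n // mul1r (le_trans eta1) //.
    by rewrite ler1n.
  rewrite ler_nat; apply: leq_trans (card_small_sets V B).
  by apply/subset_leq_card/fintype.subsetP => Z; rewrite !inE => /andP[].
exists M; split => //.
  apply: le_trans (_ : kap * #|V|%:R <= _); last first.
    by rewrite ler_wpM2r ?ler0n // ge_min lexx.
  by apply: le_trans PhiJ; rewrite ler_nat addnC leq_add2l.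
by move=> Z ZB LZ; apply: aM; rewrite inE ZB; apply/asboolP.
Qed.

(** * Solubility and perfect packings *)

Section Solubility.
Variables (R : realType) (k : nat) (U : finType) (F : kgraph k U).
Variables (V : finType) (H : kgraph k V) (d : nat) (P : 'I_d -> {set V}).
Variables (L : set 'rV[int]_d) (q : nat).
Hypotheses (partP : ordered_partition P) (latL : is_lattice L).
Hypothesis cosetsL : (coset_group #|U| L #<= `I_q)%card.

Lemma copy_max_lattice C : C \in copies F H -> max_lattice #|U| (index_vector P C.1).
Proof. by move=> CH; rewrite /max_lattice /= sum_index_vector // (card_copy CH) dvdzz. Qed.

(** [lattice_subsum] is applied to the negated index vectors of the copies, starting from the index
    vector of [V]; the full sum is 0, which lies in [L]. *)
Lemma soluble_of_perfect : has_perfect_packing F H -> soluble q P L F H.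
Proof.
move=> [M [pM cM]]; have [L0 LB] := latL.
have LM (N : {set subgraph V}) : N \subset M ->
    index_vector P (~: covered N)%SET =
      index_vector P [set: V]%SET + \sum_(C in N) - index_vector P C.1.
  move=> NM; rewrite sumrN -(index_covered P (sub_packing NM pM)).
  rewrite -(finset.setUCr (covered N)) index_vectorU; first by rewrite addrAC subrr add0r.
  by rewrite -setI_eq0 finset.setICr.
have gmax C : C \in M -> max_lattice #|U| (- index_vector P C.1).
  move=> CM; rewrite /max_lattice /= (eq_bigr (fun i => - index_vector P C.1 0 i)).
    by rewrite sumrN rpredN; exact: copy_max_lattice (fintype.subsetP pM.1 _ CM).
  by move=> i _; rewrite mxE.
have [|N [NM Nq LN]] := lattice_subsum latL gmax cosetsL (v := index_vector P [set: V]%SET).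
  by rewrite -(LM M (fintype.subxx _)) cM finset.setCT index_vector0.
by exists N; rewrite (LM N NM); split => //; exact: sub_packing pM.
Qed.

(** The final packing consists of [M0], the copies of [M] and [N] outside [S] and [A], and a
    repacking of the vertices of [A], [S] and [W]. *)
Lemma perfect_of_absorbing M0 M N D :
  packing F H M0 -> L (index_vector P (~: covered M0)%SET) ->
  packing F H M -> packing F H N -> [disjoint covered M & covered M0] ->
  covered N \subset (~: (covered M :|: covered M0))%SET ->
  (#|~: (covered M :|: covered M0) :\: covered N|%SET <= D)%N ->
  (forall Z : {set V}, (#|Z| <= D + q * #|U|)%N -> L (index_vector P Z) ->
     absorbable F H M Z) ->
  has_perfect_packing F H.
Proof.
move=> pM0 LM0 pM pN dM sN; set W := (_ :\: covered N)%SET => WD absM.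
have excl v : ~~ ((v \in covered M) && (v \in covered M0)) &&
    ((v \in covered N) ==> ~~ ((v \in covered M) || (v \in covered M0))).
  apply/andP; split; last by apply/implyP => /(fintype.subsetP sN); rewrite !inE.
  by apply/negP => /andP[vM]; rewrite (disjointFr dM vM).
have dMN : [disjoint covered M & covered N].
  rewrite disjoint_sym; apply: disjointWl sN _.
  by rewrite -setI_eq0; apply/eqP/setP => v; rewrite !inE; case: (v \in covered M); rewrite ?andbF.
have pool := packingU pM pN dMN; set Q := (M :|: N)%SET in pool.
have dWQ : [disjoint W & covered Q].
  rewrite -setI_eq0 coveredU; apply/eqP/setP => v; rewrite !inE.
  by case: (v \in covered M); case: (v \in covered N); rewrite ?andbF.
have dQ0 : [disjoint covered Q & covered M0].
  rewrite -setI_eq0 coveredU; apply/eqP/setP => v; rewrite !inE.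
  by have := excl v; case: (v \in covered M); case: (v \in covered N);
    case: (v \in covered M0).
have WQ : (W :|: covered Q = ~: covered M0)%SET.
  apply/setP => v; rewrite coveredU !inE.
  by have := excl v; case: (v \in covered M); case: (v \in covered N);
    case: (v \in covered M0).
have gmax C : C \in Q -> max_lattice #|U| (index_vector P C.1).
  by move=> CQ; apply: copy_max_lattice; exact: (fintype.subsetP pool.1).
(* The leftover [W] and all of [Q] make up the complement of [covered M0], whose index vector is in
   [L]; hence [W] and at most [q] copies suffice. *)
have [|S [SQ Sq LS]] := lattice_subsum latL gmax cosetsL (v := index_vector P W).
  by rewrite -(index_covered P pool) -index_vectorU // WQ.
have pS := sub_packing SQ pool.
have dWS : [disjoint W & covered S] by apply: disjointWr (sub_covered SQ) dWQ.
have [||A [AM dA pA]] := absM (W :|: covered S)%SET.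
- apply: (leq_trans (leq_card_setU _ _)); apply: leq_add => //.
  by apply: (leq_trans (leq_card_covered pS.1)); rewrite leq_mul2r Sq orbT.
- by rewrite index_vectorU // (index_covered P pS).
have AQ : A \subset Q by apply: fintype.subset_trans AM (finset.subsetUl _ _).
pose rest := (Q :\: (S :|: A))%SET.
have restQ : rest \subset Q := finset.subsetDl _ _.
have SAQ : (S :|: A)%SET \subset Q by rewrite finset.subUset SQ.
have dr : [disjoint covered rest & covered (S :|: A)].
  apply: disjoint_covered pool restQ SAQ _.
  by rewrite -setI_eq0 finset.setIDAC finset.setDE -setIA finset.setICr finset.setI0.
have Qsplit : covered Q = (covered rest :|: (covered S :|: covered A))%SET.
  by rewrite -!coveredU /rest; congr covered; rewrite finset.setUC -{1}(setIidPr SAQ) finset.setID.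
have prest : packable F H (covered rest).
  by exists rest; split => //; exact: sub_packing pool.
have p0 : packable F H (covered M0) by exists M0.
suff [N' [pN' cN']] : packable F H [set: V]%SET by exists N'.
have split0 :
    (covered rest :|: (covered A :|: (W :|: covered S)) = ~: covered M0)%SET.
  rewrite -WQ Qsplit; clearbody W; apply/setP => v; rewrite !inE.
  by case: (v \in W); case: (v \in covered rest); case: (v \in covered S);
    case: (v \in covered A).
rewrite -(finset.setUCr (covered M0)) -split0.
have dr' : [disjoint covered rest & covered A :|: (W :|: covered S)].
  rewrite disjoint_sym -setI_eq0 !setIUl !finset.setU_eq0 !setI_eq0.
  rewrite (disjointWr (sub_covered restQ) dWQ) /=.
  rewrite coveredU disjoint_sym -setI_eq0 setIUl finset.setU_eq0 !setI_eq0 in dr.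
  by case/andP: dr => -> ->.
apply: packableU => //; first exact: packableU.
by rewrite split0 -setI_eq0 finset.setICr.
Qed.
End Solubility.

Theorem theorem3p1 (R : realType) (k l : nat) (U : finType) (F : kgraph k U)
    (D q t : nat) (gamma c : R) :
  (l <= k - 1)%N -> (0 < k)%N -> (0 < t)%N -> 0 < gamma -> 0 < c ->
  exists beta0 mu0 : R, [/\ 0 < beta0, 0 < mu0 &
    forall beta mu : R, 0 < beta <= beta0 -> 0 < mu <= mu0 ->
    exists n0 : nat, forall (V : finType) (H : kgraph k V),
      (n0 <= #|V|)%N -> (#|U| %| #|V|)%N ->
      (packing_threshold R F l D + gamma) * 'C(#|V| - l, k - l)%:R
        <= (min_degree l H)%:R ->
      forall (d : nat) (P : 'I_d -> {set V}),
        good_partition F beta t c H P ->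
        (coset_group #|U| (robust_lattice mu P F H) #<= `I_q)%card ->
        (has_perfect_packing F H <->
         soluble q P (robust_lattice mu P F H) F H)].
Proof.
(* [n0] is chosen after [beta] and [mu] and may depend on both, so 1 will do for the two bounds. *)
move=> lk k0 _ gamma0 c0; exists 1, 1; split => // beta mu /andP[beta0 _] /andP[mu0 _].
have {}lk : (l < k)%N by rewrite -(subnK k0) addn1 ltnS.
(* If [F] has no vertices, divisibility forces n = 0, which n0 = 1 excludes. *)
have [m0|m0] := posnP #|U|.
  by exists 1%N => V H V0; rewrite m0 dvd0n => /eqP V00; rewrite V00 in V0.
have [kappa [n1 [kappa0 n1P]]] := packing_threshold_cover F D lk gamma0.
(* The sets to absorb are at most [D] leftover vertices and at most [q] copies; the forbidden set is
   [covered M0], of at most qm vertices. *)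
have [n2 n2P] := @absorbing_packing R k U F beta mu c kappa t (D + q * #|U|)
  (q * #|U|) m0 beta0 mu0 c0 kappa0.
exists (n1 + n2)%N => V H nV _ degH d P goodP cosets.
have latL := lattice_generated_is_lattice (robust_index_vectors mu P F H).
have partP := goodP.1.
split; first exact: soluble_of_perfect.
move=> [M0 [pM0 M0q LM0]].
have Phiq : (#|covered M0| <= q * #|U|)%N.
  by apply: (leq_trans (leq_card_covered pM0.1)); rewrite leq_mul2r M0q orbT.
have [M [pM dM cM absM]] := n2P V H (leq_trans (leq_addl _ _) nV) d P goodP _ Phiq.
pose W := (~: (covered M :|: covered M0))%SET.
have [|N [pN NW ND]] := n1P V H (leq_trans (leq_addr _ _) nV) degH W.
  apply: le_trans cM; rewrite finset.setCK ler_nat.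
  exact: leq_card_setU.
exact: (perfect_of_absorbing partP latL cosets pM0 LM0 pM pN dM NW ND absM).
Qed.
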